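(* Let $n$ and $m$ be positive integers. The number of rhombus tilings of the hexagon $H(2n-1,2m)$ with side lengths $2n-1,2m,2n-1,2n-1,2m,2n-1$ which contain the rhombus above and next to the central rhombus (that is, the axis rhombus $\rho_l$ with $l=n+m$) equals \begin{multline*} \frac{(2 m-1) \binom{2 m-2}{m-1} \binom{2 n-4}{n-2}\binom{2 n+2}{n+1}}{(n + m - 1)(n + m)\binom{4 n + 2 m - 3}{2 n + m - 2}} \Biggl(\frac{n(n + 1)(2 n - 3)(2 n - 1)(m^2 - m -3n + 2 mn + n^2 + 2)}{(n - 1)(n + m - 1)(n + m)(2 n + 1)}\\ +\frac{6}{(n+m-2)(n+m+1)}\sum_{h = 0}^{n - 2}\frac{(3)_h\,(\frac52)_h\,(2-n)_h\,(\frac32+n)_h\,(2-n-m)_h\,(1+n+m)_h}{(1)_h\,(\frac32)_h\,(2+n)_h\,(\frac52-n)_h\,(2+n+m)_h\,(3-n-m)_h}\Biggr)\\ \times\prod_{i=1}^{2n-1}\prod_{j=1}^{2m}\prod_{k=1}^{2n-1}\frac{i+j+k-1}{i+j+k-2}. \end{multline*}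
   Context: Shifted factorial: $(a)_0:=1$ and $(a)_k:=a(a+1)\cdots(a+k-1)$ for $k\ge1$. Singular expressions are to be read as the appropriate limit; here this concerns only $n=1$, where the sum is empty (so the second term in the large parentheses is $0$) and $\binom{2n-4}{n-2}\cdot\frac1{n-1}$ is read as $\lim_{n\to1}\frac{\Gamma(2n-3)}{\Gamma(n-1)^2\,(n-1)}=-\frac12$. Hexagon: $H(N,M)$ is the hexagon with all angles $120^\circ$ and side lengths, in cyclic order, $N,M,N,N,M,N$, placed with vertices $(0,0)$, $(\pm\frac{\sqrt3}{2}N,\frac N2)$, $(\pm\frac{\sqrt3}{2}N,\frac N2+M)$, $(0,N+M)$ (the sides of length $M$ are vertical). It is subdivided into unit equilateral triangles by the triangular lattice generated by $(0,1)$ and $(\frac{\sqrt3}2,\frac12)$. A rhombus is the union of two unit lattice triangles sharing an edge (side lengths 1, angles $60^\circ$ and $120^\circ$); a rhombus tiling of $H(N,M)$ is a covering of $H(N,M)$ by such rhombi without overlaps. Axis rhombi: for $0\le l\le N+M-1$, $\rho_l$ is the rhombus with vertices $(0,l)$, $(0,l+1)$, $(\pm\frac{\sqrt3}{2},l+\frac12)$; these are the rhombi symmetric about the vertical symmetry axis (of length $N+M$). When $N+M$ is odd, the central rhombus is $\rho_{(N+M-1)/2}$. *)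

(* Defs.v *)
From mathcomp Require Import all_boot all_order all_algebra.

Set Implicit Arguments.
Unset Strict Implicit.
Unset Printing Implicit Defensive.

Import Order.TTheory GRing.Theory Num.Theory.
Local Open Scope ring_scope.

(* A point of the triangular lattice is given by its coordinates in the basis
   (sqrt 3 / 2, 1 / 2), (0, 1): (a, b) has Cartesian coordinates
   (a * sqrt 3 / 2, b + a / 2). *)
Definition lattice_point := (int * int)%type.

(* The closed hexagon with sides N, M, N, N, M, N and (in lattice coordinates)
   vertices (0, 0), (N, 0), (N, M), (0, N + M), (- N, N + M), (- N, N); the six
   inequalities are those of its six edge lines. *)
Definition in_hexagon (N M : nat) (p : lattice_point) : bool :=
  [&& - N%:Z <= p.1 <= N%:Z,
      0 <= p.2 <= (N + M)%:Z &
      0 <= p.1 + p.2 <= (N + M)%:Z].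

(* Every unit lattice triangle has exactly one vertical edge, and lies to the
   right or to the left of it.  (to_right, i, j) stands for the triangle with
   vertical edge from (i - N, j) to (i - N, j + 1), lying to the right of that
   edge iff the boolean is true.  The index ranges cover all vertical unit edges
   inside the hexagon. *)
Definition triangle (N M : nat) := (bool * 'I_(2 * N).+1 * 'I_(N + M))%type.

Definition vertices (N M : nat) (t : triangle N M) : seq lattice_point :=
  let: (to_right, i, j) := t in
  let a := i%:Z - N%:Z in
  let b := j%:Z in
  [:: (a, b); (a, b + 1); if to_right then (a + 1, b) else (a - 1, b + 1)].

Definition hexagon (N M : nat) : {set triangle N M} :=
  [set t | all (in_hexagon N M) (vertices t)].

Definition share_edge (N M : nat) (t u : triangle N M) : bool :=
  count [in vertices u] (vertices t) == 2%N.

(* A region made of unit triangles is represented by the set of these. *)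
Definition is_rhombus (N M : nat) (r : {set triangle N M}) : bool :=
  [exists t, exists u, share_edge t u && (r == [set t; u])].

Definition rhombus_tiling (N M : nat) (T : {set {set triangle N M}}) : bool :=
  partition T (hexagon N M) && [forall r in T, is_rhombus r].

(* The rhombus with Cartesian vertices (0, l), (0, l + 1) and
   (+- sqrt 3 / 2, l + 1 / 2). *)
Definition axis_rhombus (N M l : nat) : {set triangle N M} :=
  [set t | all [in [:: (0, l%:Z); (0, l%:Z + 1); (1, l%:Z); (-1, l%:Z + 1)]]
               (vertices t)].

Definition shifted_factorial (a : rat) (k : nat) : rat :=
  \prod_(0 <= i < k) (a + i%:R).

(* binomial(2n - 4, n - 2) / (n - 1), read at n = 1 as the limit
   of Gamma(2n - 3) / (Gamma(n - 1)^2 (n - 1)), which is - 1/2. *)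
Definition binom_quotient (n : nat) : rat :=
  if n == 1%N then - (1 / 2) else 'C(2 * n - 4, n - 2)%:R / (n%:R - 1).

(* Main.v *)
Require Import Defs.
From mathcomp Require Import all_boot all_order all_algebra.
From mathcomp Require Import zify ring lra.

Set Implicit Arguments.
Unset Strict Implicit.
Unset Printing Implicit Defensive.

Import Order.TTheory GRing.Theory Num.Theory.
Local Open Scope ring_scope.

(** Put N = 2n-1, M = 2m, L = N+M.  Cutting a tiling along the vertical lattice
    lines turns it into M nonintersecting paths that start at heights
    N, ..., L-1 on the left side, end at heights 0, ..., M-1 on the right side
    and lose 0 or 1 at each of 2N steps; the tiling contains the axis rhombus at
    height l iff no path passes through l after N steps.  So the tilings are
    counted by det (A D A^T), where A is the M x L matrix of binomials
    C(N, N+i-v) and D deletes column l.  Up to the sign (-1)^v the rows of A are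
    N-th differences, hence orthogonal to all polynomials of degree < N on
    {0, ..., L-1}; therefore det (A D A^T) = det (A A^T) K, where
    K = sum_(k < N) p_k(l)^2 / h_k and the p_k are the monic discrete Chebyshev
    polynomials, of norm h_k, and det (A A^T) = prod_(k < N) h_k / k!^2 is the
    triple product.

    As L is odd and l is next to the centre, the three-term recurrence gives
    p_k(l) in closed form.  For fixed n+m the claimed value of K then satisfies
    the recurrence K(n+1) - K(n) = (two closed-form terms): the summands of the
    hypergeometric sums for n+1 and n differ by terms in which n+m only enters
    as a common factor, and those are Gosper-summable. *)

(** * Nonintersecting paths *)

(* One column of a tiling, as a map on the heights of the triangles lying right
   of that column: [None] if the triangle is matched with the one left of its
   vertical edge, [Some d] if it is matched in the next column, [d] levels
   lower.  The heights mapped to [Some _] are the positions of the paths. *)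
Definition pattern (L : nat) := {ffun 'I_L -> option bool}.

Definition fall (o : option bool) : nat := o == Some true.

Definition source (L : nat) (E : pattern L) : seq nat :=
  [seq val j | j <- enum 'I_L & E j].

Definition target (L : nat) (E : pattern L) : seq nat :=
  [seq (val j - fall (E j))%N | j <- enum 'I_L & E j].

(** Truncated subtraction would turn a drop from height 0 into a level step; this condition excludes
    such drops. *)
Definition grounded (L : nat) (E : pattern L) : bool :=
  [forall j, (E j == Some true) ==> (0 < j)%N].

(* [c k v] tells whether a path may be at height [v] when [k] steps remain. *)
Fixpoint chain (L : nat) (c : nat -> nat -> bool) (final r : seq nat)
    (s : seq (pattern L)) : bool :=
  if s is E :: s' then
    [&& source E == r, all (c (size s)) r, grounded E,
        sorted ltn (target E) & chain c final (target E) s']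
  else r == final.

(** Mirrors [chain] for a single path: the height is tested before each step against the number of
    remaining steps, and the factor [(0 < r)] plays the part of [grounded]. *)
Fixpoint path_count (c : nat -> nat -> bool) (k r j : nat) : rat :=
  if k is k'.+1 then
    (c k r)%:R * (path_count c k' r j
                  + (0 < r)%N%:R * path_count c k' r.-1 j)
  else (r == j)%:R.

Lemma sum_tuple_cons (V : nmodType) (T : finType) (k : nat)
    (F : seq T -> V) :
  \sum_(s : k.+1.-tuple T) F s = \sum_x \sum_(s : k.-tuple T) F (x :: s).
Proof.
rewrite pair_big /= (reindex (fun p : T * k.-tuple T => [tuple of p.1 :: p.2])) //.
exists (fun t : k.+1.-tuple T => (thead t, [tuple of behead t])) => /=.
  by move=> [x s] _ /=; congr pair; apply: val_inj.
by move=> t _; rewrite [RHS]tuple_eta; apply: val_inj.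
Qed.

(** Multilinearity in all rows at once: each product in the Leibniz expansion distributes over the
    choice functions [f]. *)
Lemma det_sum_rows (R : comNzRingType) (n : nat) (J : finType)
    (a : 'I_n -> J -> 'I_n -> R) :
  \det (\matrix_(i, j) \sum_b a i b j)
  = \sum_(f : {ffun 'I_n -> J}) \det (\matrix_(i, j) a i (f i) j).
Proof.
rewrite exchange_big /=; apply: eq_bigr => s _.
under eq_bigr do rewrite mxE.
rewrite bigA_distr_bigA mulr_sumr; apply: eq_bigr => f _.
by congr (_ * _); apply: eq_bigr => i _; rewrite mxE.
Qed.

Lemma det_scale_rows (R : comNzRingType) (n : nat) (a : 'I_n -> R)
    (A : 'I_n -> 'I_n -> R) :
  \det (\matrix_(i, j) (a i * A i j)) = \prod_i a i * \det (\matrix_(i, j) A i j).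
Proof.
rewrite mulr_sumr; apply: eq_bigr => s _.
rewrite mulrCA -big_split /=; congr (_ * _).
by apply: eq_bigr => i _; rewrite !mxE.
Qed.

(** Pigeonhole principle. For paths with no step left it shows that any sorted state other than the
    final one contains a height of at least [M]. *)
Lemma sorted_subrange (r : seq nat) :
  sorted ltn r -> all (fun v => v < size r)%N r -> r = iota 0 (size r).
Proof.
move=> sr /allP lr; have ur := sorted_uniq ltn_trans ltnn sr.
have sub: {subset r <= iota 0 (size r)}.
  by move=> x /lr; rewrite mem_iota.
have [|_ eqr] := uniq_min_size ur sub; first by rewrite size_iota.
exact: (irr_sorted_eq ltn_trans ltnn sr (iota_ltn_sorted _ _)).
Qed.

Lemma mem_source (L : nat) (E : pattern L) (v : nat) :
  reflect (exists2 j : 'I_L, E j & val j = v) (v \in source E).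
Proof.
apply: (iffP mapP) => -[j].
  by rewrite mem_filter => /andP[Ej _] ->; exists j.
by move=> Ej <-; exists j; rewrite // mem_filter Ej mem_enum.
Qed.

Lemma mem_target (L : nat) (E : pattern L) (v : nat) :
  reflect (exists2 j : 'I_L, E j & (val j - fall (E j))%N = v) (v \in target E).
Proof.
apply: (iffP mapP) => -[j].
  by rewrite mem_filter => /andP[Ej _] ->; exists j.
by move=> Ej <-; exists j; rewrite // mem_filter Ej mem_enum.
Qed.

Lemma sorted_source (L : nat) (E : pattern L) : sorted ltn (source E).
Proof.
have sL : sorted ltn [seq val j | j <- enum 'I_L].
  by rewrite val_enum_ord iota_ltn_sorted.
rewrite (subseq_sorted ltn_trans _ sL) //.
by apply: map_subseq; apply: filter_subseq.
Qed.

Lemma size_target (L : nat) (E : pattern L) : size (target E) = size (source E).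
Proof. by rewrite !size_map. Qed.

(** [index (val j) r] is the number of the path at height [j]; it equals [size r] when there is
    none, and [insub] then yields [None]. *)
Definition pattern_of (L M : nat) (r : seq nat) (d : {ffun 'I_M -> bool}) :
    pattern L :=
  [ffun j : 'I_L => omap d (insub (index (val j) r))].

Definition falls_of (L M : nat) (r : seq nat) (E : pattern L) :
    {ffun 'I_M -> bool} :=
  [ffun i : 'I_M => oapp (fun j => E j == Some true) false
                         (insub (nth 0%N r i))].

Section PatternOf.
Variables (L M : nat) (r : seq nat).
Hypotheses (r_sorted : sorted ltn r) (r_size : size r = M).
Hypothesis r_lt : all (fun v => v < L)%N r.

Let nth_lt (i : 'I_M) : (nth 0%N r i < L)%N.
Proof. by apply: (all_nthP 0%N r_lt); rewrite r_size. Qed.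

Let r_uniq : uniq r. Proof. exact: sorted_uniq ltn_trans ltnn _ r_sorted. Qed.

Lemma pattern_of_nth (d : {ffun 'I_M -> bool}) (i : 'I_M) :
  pattern_of L r d (Ordinal (nth_lt i)) = Some (d i).
Proof.
by rewrite ffunE /= index_uniq ?r_size ?ltn_ord // valK.
Qed.

Lemma source_pattern_of (d : {ffun 'I_M -> bool}) :
  source (pattern_of L r d) = r.
Proof.
apply: (irr_sorted_eq ltn_trans ltnn (sorted_source _) r_sorted) => v.
apply/mem_source/idP => [[j]|vr].
  rewrite ffunE; case: insubP => /= [i lt_i _ _ <-|//].
  by rewrite -index_mem r_size.
have vi : (index v r < M)%N by rewrite -r_size index_mem.
exists (Ordinal (nth_lt (Ordinal vi))); last by rewrite /= nth_index.
by rewrite pattern_of_nth.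
Qed.

Lemma pattern_ofK (d : {ffun 'I_M -> bool}) :
  falls_of M r (pattern_of L r d) = d.
Proof.
apply/ffunP => i; rewrite ffunE insubT ?nth_lt // => lt_i.
have -> : Sub (nth 0%N r i) lt_i = Ordinal (nth_lt i) by apply: val_inj.
by rewrite /= pattern_of_nth; case: (d i).
Qed.

Lemma falls_ofK (E : pattern L) :
  source E = r -> pattern_of L r (falls_of M r E) = E.
Proof.
move=> Er; apply/ffunP => j; rewrite ffunE.
case: insubP => /= [i _ iE|].
  have jr : val j \in r by rewrite -index_mem r_size -iE.
  have /mem_source[j' Ej' /val_inj ej] : val j \in source E by rewrite Er.
  move: Ej'; rewrite {j'}ej => Ej.
  rewrite ffunE iE nth_index // valK /=.
  by case: (E j) Ej => // -[].
rewrite -r_size index_mem => jr; case Ej: (E j) => [d|] //.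
by case/negP: jr; rewrite -Er; apply/mem_source; exists j; rewrite ?Ej.
Qed.

Lemma target_pattern_of (d : {ffun 'I_M -> bool}) :
  target (pattern_of L r d) = [seq (nth 0%N r i - d i)%N | i : 'I_M].
Proof.
set E := pattern_of L r d; have Er : source E = r by apply: source_pattern_of.
have sz : size (target E) = M by rewrite size_target Er.
have szF : size [seq j <- enum 'I_L | E j] = M by rewrite -r_size -Er size_map.
apply: (@eq_from_nth _ 0%N) => [|i lti]; first by rewrite sz size_image card_ord.
rewrite sz in lti; pose i' := Ordinal lti; have j0 := Ordinal (nth_lt i').
rewrite (nth_map j0) ?szF // (nth_map i') ?size_enum_ord //.
have -> : nth i' (enum 'I_M) i = i' by apply: val_inj; rewrite /= nth_enum_ord.
have ej : nth j0 [seq j <- enum 'I_L | E j] i = Ordinal (nth_lt i').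
  by apply: val_inj; rewrite /= -Er (nth_map j0) // szF.
by rewrite ej pattern_of_nth /=; case: (d i').
Qed.

Lemma grounded_pattern_of (d : {ffun 'I_M -> bool}) :
  grounded (pattern_of L r d) = [forall i : 'I_M, d i ==> (0 < nth 0%N r i)%N].
Proof.
apply/forallP/forallP => [g i|g j].
  by have := g (Ordinal (nth_lt i)); rewrite pattern_of_nth; case: (d i).
apply/implyP; rewrite ffunE; case: insubP => //= i _ iE /eqP[di].
have := g i; rewrite di iE nth_index //.
by rewrite -index_mem r_size -iE.
Qed.

(** A pattern with source [r] amounts to a choice of the paths that drop. This brings the sum into
    the form to which multilinearity in the rows applies. *)
Lemma sum_patterns (V : nmodType) (F : seq nat -> V) :
  \sum_(E : pattern L | [&& source E == r, grounded E & sorted ltn (target E)])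
    F (target E)
  = \sum_(d : {ffun 'I_M -> bool} |
             [forall i : 'I_M, d i ==> (0 < nth 0%N r i)%N]
             && sorted ltn [seq (nth 0%N r i - d i)%N | i : 'I_M])
      F [seq (nth 0%N r i - d i)%N | i : 'I_M].
Proof.
rewrite (reindex_onto (pattern_of L r) (falls_of M r)) /=; last first.
  by move=> E /and3P[/eqP Er _ _]; rewrite falls_ofK.
apply: eq_big => [d|d _]; last by rewrite target_pattern_of.
by rewrite source_pattern_of grounded_pattern_of target_pattern_of pattern_ofK
  !eqxx andbT.
Qed.

End PatternOf.

(* Strictly increasing heights that each drop by at most 1 can only stop being
   strictly increasing through a coincidence. *)
Lemma det_unsorted_rows (M : nat) (F : nat -> nat -> rat) (r : seq nat)
    (d : 'I_M -> bool) :
  sorted ltn r -> size r = M ->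
  ~~ sorted ltn [seq (nth 0%N r i - d i)%N | i : 'I_M] ->
  [forall i : 'I_M, d i ==> (0 < nth 0%N r i)%N] ->
  \det (\matrix_(i < M, j < M) F (nth 0%N r i - d i)%N j) = 0.
Proof.
move=> sr szr; rewrite (sorted_pairwise ltn_trans) => /(pairwiseP 0%N) unsorted.
move=> /forallP ground.
case: (boolP [exists i : 'I_M, exists j : 'I_M, (i < j)%N
   && (nth 0%N r i - d i == nth 0%N r j - d j)%N]).
  case/existsP=> i /existsP[j /andP[ij /eqP eq_ij]].
  apply: (determinant_alternate (i1 := i) (i2 := j)).
    by apply: contraTneq ij => ->; rewrite ltnn.
  by move=> k; rewrite !mxE eq_ij.
rewrite negb_exists => /forallP noeq; case: unsorted => i j.
rewrite !inE size_image card_ord => lti ltj ij.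
have nthE (k : nat) (ltk : (k < M)%N) :
    nth 0%N [seq (nth 0%N r i0 - d i0)%N | i0 : 'I_M] k
    = (nth 0%N r k - d (Ordinal ltk))%N.
  rewrite (nth_map (Ordinal ltk)) ?size_enum_ord //.
  have -> : nth (Ordinal ltk) (enum 'I_M) k = Ordinal ltk.
    by apply: val_inj; rewrite /= nth_enum_ord.
  by [].
rewrite (nthE i lti) (nthE j ltj).
have lt_r : (nth 0%N r i < nth 0%N r j)%N.
  move: sr; rewrite (sorted_pairwise ltn_trans) => /(pairwiseP 0%N).
  by apply; rewrite // inE szr.
have := noeq (Ordinal lti); rewrite negb_exists => /forallP/(_ (Ordinal ltj)).
have := ground (Ordinal ltj); have := ground (Ordinal lti); rewrite /= ij /=.
case: (d _) => /=; case: (d _) => /=; lia.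
Qed.

(* Lindstroem-Gessel-Viennot without an involution: the determinant is expanded
   by multilinearity over the first step of all paths, and the families that
   collide at this step contribute determinants with two equal rows. *)
Theorem card_chain (L M : nat) (c : nat -> nat -> bool) (k : nat) (r : seq nat) :
  sorted ltn r -> size r = M -> all (fun v => v < L)%N r ->
  #|[set s : k.-tuple (pattern L) | chain c (iota 0 M) r s]|%:R
  = \det (\matrix_(i < M, j < M) path_count c k (nth 0%N r i) j).
Proof.
have cardE k' (P : pred (seq (pattern L))) :
    #|[set s : k'.-tuple (pattern L) | P s]|%:R
    = \sum_(s : k'.-tuple (pattern L)) (P s)%:R :> rat.
  rewrite cardsE -sum1_card natr_sum big_mkcond; apply: eq_bigr => s _.
  by rewrite unfold_in; case: (P s).
elim: k r => [|k IHk] r sr szr ltr.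
  rewrite cardE (big_pred1 [tuple]) => [|s]; last by rewrite [s]tuple0 /= eqxx.
  rewrite /=; case: (altP (r =P iota 0 M)) => [->|neq_r].
 
    transitivity (\det (1%:M : 'M[rat]_M)); first by rewrite det1.
    by congr (\det _); apply/matrixP => i j; rewrite !mxE nth_iota ?ltn_ord.
  (* A height of at least [M] gives a zero row, since no column has that index. *)
  case: (boolP (all (fun v => v < size r)%N r)) => [lt_r|].
    by case/eqP: neq_r; rewrite -szr; apply: sorted_subrange.
  case/allPn=> v vr ge_v; have lt_i : (index v r < M)%N by rewrite -szr index_mem.
  rewrite (expand_det_row _ (Ordinal lt_i)) big1 // => j _.
  have lt_jv : (j < v)%N by apply: (leq_trans (ltn_ord j)); rewrite -szr leqNgt.
  by rewrite mxE /= nth_index //; rewrite eqn_leq [(v <= j)%N]leqNgt lt_jv mul0r.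
rewrite cardE (sum_tuple_cons _ (fun s => (chain c (iota 0 M) r s)%:R)).
transitivity (\sum_(E : pattern L |
     [&& source E == r, grounded E & sorted ltn (target E)])
   ((all (c k.+1) r)%:R * \det (\matrix_(i < M, j < M)
          path_count c k (nth 0%N (target E) i) j))).
  rewrite [RHS]big_mkcond; apply: eq_bigr => E _ /=.
  have [/eqP Er /=|/= _] := boolP (source E == r); last by rewrite big1.
  have [gE|/= _] := boolP (grounded E); last first.
    by rewrite big1 // => s _; rewrite andbF.
  have [sE|/= _] := boolP (sorted _ _); last first.
    by rewrite big1 // => s _; rewrite !andbF.
  rewrite -IHk ?size_target ?Er //; last first.
    apply/allP => v /mem_target[j _ <-].
    by apply: leq_ltn_trans (ltn_ord j); apply: leq_subr.
  rewrite cardE mulr_sumr; apply: eq_bigr => s _.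
  by rewrite /= size_tuple -natrM mulnb.
rewrite (sum_patterns sr szr ltr (fun t => (all (c k.+1) r)%:R *
   \det (\matrix_(i < M, j < M) path_count c k (nth 0%N t i) j))).
rewrite -mulr_sumr.
have -> : (all (c k.+1) r)%:R = \prod_(i < M) (c k.+1 (nth 0%N r i))%:R :> rat.
  have [/(all_nthP 0%N) cr|] := boolP (all _ _).
    by rewrite big1 // => i _; rewrite cr ?szr.
  case/allPn=> v vr /negbTE cv; have lt_i : (index v r < M)%N by rewrite -szr index_mem.
  by rewrite (bigD1 (Ordinal lt_i)) //= nth_index // cv mul0r.
rewrite /= det_scale_rows; congr (_ * _).
(* Ungrounded choices get a zero factor in some row, and unsorted targets contribute 0 by
   [det_unsorted_rows], so the sum may run over all choices. *)
transitivity (\sum_(d : {ffun 'I_M -> bool}) \det (\matrix_(i < M, j < M)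
   ((d i ==> (0 < nth 0%N r i)%N)%:R * path_count c k (nth 0%N r i - d i) j))).
  rewrite big_mkcond; apply: eq_bigr => d _.
  rewrite det_scale_rows; case: (boolP [forall i, _]) => [gd|].
    rewrite big1 => [|i _]; last by rewrite (forallP gd).
    rewrite mul1r /=; case: ifP => [_|/negbT ns].
      congr (\det _); apply/matrixP => i j; rewrite !mxE (nth_map i) ?size_enum_ord //.
      by rewrite nth_ord_enum.
    by rewrite det_unsorted_rows.
  rewrite negb_forall => /existsP[i /negbTE gi].
  by rewrite (bigD1 i) //= gi !mul0r.
rewrite -(det_sum_rows (fun (i : 'I_M) (b : bool) (j : 'I_M) =>
   (b ==> (0 < nth 0%N r i)%N)%:R * path_count c k (nth 0%N r i - b) j)).
congr (\det _); apply/matrixP => i j; rewrite !mxE big_bool /=.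
by rewrite subn0 subn1 mul1r addrC.
Qed.

(** * Tilings as families of paths *)

Definition blank (L : nat) : pattern L := [ffun => None].

Definition state (L : nat) (r : seq nat) (s : seq (pattern L)) (k : nat) :
    seq nat :=
  if k is k'.+1 then target (nth (blank L) s k') else r.

(** Replaces the recursion by one condition per index [k], so that the columns of a tiling can be
    treated separately. *)
Lemma chainP (L : nat) (c : nat -> nat -> bool) (final r : seq nat)
    (s : seq (pattern L)) :
  reflect ((forall k, (k < size s)%N -> let E := nth (blank L) s k in
              [/\ source E = state r s k, all (c (size s - k)%N) (state r s k),
                  grounded E & sorted ltn (target E)])
           /\ state r s (size s) = final)
          (chain c final r s).
Proof.
elim: s r => [|E s IHs] r /=.
  by apply: (iffP eqP) => [->|[_ ->]].
apply: (iffP and5P) => [[/eqP Er cr gE sE /IHs[step end_s]]|[step end_s]].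
  split=> [[|k] /= ltk|]; first by rewrite Er.
    have [] := step k ltk; rewrite subSS => sk ck gk tk; split=> //.
      by rewrite sk; case: (k).
    by case: (k) ck.
  by rewrite -end_s; case: (s).
have [Er cr gE sE] := step 0%N isT; split=> //; first exact/eqP.
apply/IHs; split=> [k ltk|]; last by rewrite -end_s; case: (s).
have [] := step k.+1 ltk; rewrite /= subSS => sk ck gk tk; split=> //.
  by rewrite sk; case: (k).
by case: (k) ck.
Qed.

Lemma partition_pairs (I T : finType) (A : {set I}) (f g : I -> T) :
  {in A &, injective f} -> {in A &, injective g} ->
  (forall p q, p \in A -> q \in A -> f p != g q) ->
  partition [set [set f p; g p] | p in A] (f @: A :|: g @: A).
Proof.
move=> injf injg fg; apply/and3P; split.
- rewrite /cover; apply/eqP/setP => x; apply/bigcupP/setUP.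
    by case=> _ /imsetP[p pA ->] /set2P[]->; [left|right]; apply: imset_f.
  case=> /imsetP[p pA ->]; exists [set f p; g p]; rewrite ?set21 ?set22 //;
    exact: imset_f.
- apply/trivIsetP => _ _ /imsetP[p pA ->] /imsetP[q qA ->] neq.
  apply/pred0P => x /=; apply/negP => /andP[/set2P[]-> /set2P[]] eq.
  + by case/eqP: neq; rewrite (injf p q).
  + by move: (fg p q pA qA); rewrite eq eqxx.
  + by move: (fg q p qA pA); rewrite eq eqxx.
  + by case/eqP: neq; rewrite (injg p q).
by apply/imsetP => -[p _ /setP/(_ (f p))]; rewrite !inE eqxx.
Qed.

Lemma right_in_hexagon (N M : nat) (i : 'I_(2 * N).+1) (j : 'I_(N + M)) :
  ((true, i, j) \in hexagon N M) = (i < 2 * N)%N && (N <= i + j < 2 * N + M)%N.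
Proof.
rewrite inE /= /in_hexagon /=; have := ltn_ord i; have := ltn_ord j; lia.
Qed.

Lemma left_in_hexagon (N M : nat) (i : 'I_(2 * N).+1) (j : 'I_(N + M)) :
  ((false, i, j) \in hexagon N M) = (0 < i)%N && (N <= i + j < 2 * N + M)%N.
Proof.
rewrite inE /= /in_hexagon /=; have := ltn_ord i; have := ltn_ord j; lia.
Qed.

(** The three neighbours of a right triangle: the left triangle across its vertical edge, then the
    two in the next column across its slanted edges. *)
Definition adjacent (i j i' j' : nat) : bool :=
  [|| (i' == i) && (j' == j), (i' == i.+1) && (j' == j)
    | (i' == i.+1) && (j'.+1 == j)]%N.

Ltac decide_int_equalities :=
  repeat (match goal with
          | |- context [(?x == ?y :> int)] => case: (x =P y) => ?
          end; try (exfalso; lia)).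

Lemma share_edge_same (N M : nat) (b : bool) (i i' : 'I_(2 * N).+1)
    (j j' : 'I_(N + M)) :
  share_edge (b, i, j) (b, i', j') = false.
Proof.
rewrite /share_edge; case: b; rewrite /= !inE !xpair_eqE;
  by decide_int_equalities.
Qed.

Lemma share_edge_right (N M : nat) (i i' : 'I_(2 * N).+1) (j j' : 'I_(N + M)) :
  share_edge (true, i, j) (false, i', j') = adjacent i j i' j'.
Proof.
rewrite /share_edge /= !inE !xpair_eqE.
by decide_int_equalities; rewrite /adjacent /=; lia.
Qed.

Lemma share_edgeC (N M : nat) (t u : triangle N M) : share_edge t u = share_edge u t.
Proof.
have uniq_vertices (t' : triangle N M) : uniq (vertices t').
  by case: t' => [[[] i] j]; rewrite /= !inE !xpair_eqE; lia.
rewrite /share_edge -!size_filter; congr (_ == _); apply/perm_size/uniq_perm.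
- by rewrite filter_uniq ?uniq_vertices.
- by rewrite filter_uniq ?uniq_vertices.
by move=> p; rewrite !mem_filter andbC.
Qed.

Section TilingsAsChains.
Variables (N M l : nat).
Hypotheses (N_gt0 : (0 < N)%N) (l_lt : (l < N + M)%N).

Implicit Types (p q : 'I_(2 * N) * 'I_(N + M)) (s : seq (pattern (N + M))).

Definition lower (d : bool) (j : 'I_(N + M)) : 'I_(N + M) :=
  Ordinal (leq_ltn_trans (leq_subr d j) (ltn_ord j)).

Definition right_of p : triangle N M := (true, widen_ord (leqnSn _) p.1, p.2).

Definition mate_of (o : option bool) p : triangle N M :=
  if o is Some d then (false, lift ord0 p.1, lower d p.2)
  else (false, widen_ord (leqnSn _) p.1, p.2).

Definition entry s p : option bool := nth (blank (N + M)) s p.1 p.2.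

(* The positions of the right triangles of the hexagon. *)
Definition inside : {set 'I_(2 * N) * 'I_(N + M)} :=
  [set p : 'I_(2 * N) * 'I_(N + M) | (N <= p.1 + p.2 < 2 * N + M)%N].

Definition tiling_of s : {set {set triangle N M}} :=
  [set [set right_of p; mate_of (entry s p) p] | p in inside].

(** [k] counts remaining steps; of the [2 * N] steps, [N] remain exactly on the vertical axis. *)
Definition avoids_axis (k v : nat) : bool := (k == N) ==> (v != l).

Definition is_tiling_chain s :=
  chain avoids_axis (iota 0 M) (iota N M) s.

(** A perfect matching of right with left triangles of the hexagon, half-way between chains and
    tilings. The first clause forbids paths outside the hexagon, so that a tiling determines [s]. *)
Definition matching s :=
  [/\ forall p, entry s p -> p \in inside,
      {in inside &, injective (fun p => mate_of (entry s p) p)},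
      forall i j, (false, i, j) \in hexagon N M ->
        exists2 p, p \in inside & mate_of (entry s p) p = (false, i, j) &
      forall p, p \in inside -> mate_of (entry s p) p \in hexagon N M].

Lemma right_of_inj : injective right_of.
Proof. by move=> [i j] [i' j'] [/= ei ->]; congr pair; apply: val_inj. Qed.

Lemma right_of_hexagon p : (right_of p \in hexagon N M) = (p \in inside).
Proof. by rewrite right_in_hexagon inE /= ltn_ord. Qed.

Lemma hexagon_right (i : 'I_(2 * N).+1) (j : 'I_(N + M)) :
  (true, i, j) \in hexagon N M ->
  exists2 p, p \in inside & right_of p = (true, i, j).
Proof.
move=> tH; have lt_i : (i < 2 * N)%N by move: tH; rewrite right_in_hexagon => /andP[].
have eq_t : right_of (Ordinal lt_i, j) = (true, i, j).
  by congr (_, _, _); apply: val_inj.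
by exists (Ordinal lt_i, j); rewrite // -right_of_hexagon eq_t.
Qed.

Lemma mate_of_left o p : (mate_of o p).1.1 = false.
Proof. by case: o. Qed.

Lemma partition_matching s : matching s -> partition (tiling_of s) (hexagon N M).
Proof.
case=> supp inj surj inH.
have -> : hexagon N M
    = right_of @: inside :|: (fun p => mate_of (entry s p) p) @: inside.
  apply/setP => t; apply/idP/setUP => [tH|[]].
  - move: tH; case: t => [[[] i] j] tH; [left|right].
      by have [p pin <-] := hexagon_right tH; apply: imset_f.
    by have [p pin <-] := surj _ _ tH; apply: imset_f.
  - by case/imsetP=> p pin ->; rewrite right_of_hexagon.
  - by case/imsetP=> p pin ->; apply: inH.
apply: (partition_pairs (f := right_of)) => //; first exact: in2W right_of_inj.
by move=> p q _ _; apply/eqP => /(congr1 (fun t => t.1.1)); rewrite mate_of_left.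
Qed.

Lemma is_rhombus_pair o p : (o == Some true) ==> (0 < p.2)%N ->
  is_rhombus [set right_of p; mate_of o p].
Proof.
move=> gr; apply/existsP; exists (right_of p); apply/existsP; exists (mate_of o p).
rewrite eqxx andbT; case: o gr => [d|] /= gr; rewrite share_edge_right /adjacent /=.
  by rewrite /bump /= ; case: d gr => /= gr; lia.
by lia.
Qed.

(** The lower bound is carried forward from the starting heights, the upper bound backward from the
    final ones, because each step drops by 0 or 1. *)
Lemma chain_states s : size s = (2 * N)%N -> is_tiling_chain s ->
  forall k v, (k <= 2 * N)%N -> v \in state (iota N M) s k ->
    (v < N + M)%N && (N <= k + v < 2 * N + M)%N.
Proof.
move=> szs /chainP[step last_state].
have lower_bound k v : (k <= 2 * N)%N -> v \in state (iota N M) s k ->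
    (v < N + M)%N /\ (N <= k + v)%N.
  elim: k v => [|k IHk] v ltk; first by rewrite mem_iota; lia.
  have [sk _ _ _] := step k (eq_ind_r (fun n => k < n)%N ltk szs).
  case/mem_target=> j Ej <-.
  have : val j \in state (iota N M) s k by rewrite -sk; apply/mem_source; exists j.
  by case/(IHk _ (ltnW ltk)); rewrite /fall; case: (_ == _) => /=; lia.
have upper_bound k v : (k <= 2 * N)%N -> v \in state (iota N M) s (2 * N - k) ->
    (2 * N - k + v < 2 * N + M)%N.
  elim: k v => [|k IHk] v ltk.
    by rewrite subn0 -szs last_state mem_iota; lia.
  have lt_s : (2 * N - k.+1 < size s)%N by rewrite szs; lia.
  have [<- _ _ _] := step _ lt_s; case/mem_source=> j Ej <-.
  have := IHk (val j - fall (nth (blank (N + M)) s (2 * N - k.+1) j))%N (ltnW ltk).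
  rewrite (_ : (2 * N - k = (2 * N - k.+1).+1)%N); last by lia.
  have tj : (val j - fall (nth (blank (N + M)) s (2 * N - k.+1) j))%N
      \in target (nth (blank (N + M)) s (2 * N - k.+1)).
    by apply/mem_target; exists j.
  by move/(_ tj); rewrite /fall; case: (_ == _) => /=; lia.
move=> k v lek vk; have [lt_v ge_v] := lower_bound k v lek vk.
have /upper_bound : (2 * N - k <= 2 * N)%N by apply: leq_subr.
by rewrite subKn // => /(_ v vk) ub; rewrite lt_v ge_v.
Qed.

(** A left triangle at height [j] of column [i] is reached from the previous column if a path is
    there, and is paired across its vertical edge otherwise. Both cannot happen, since the paths
    arriving at a column are those leaving it. *)
Lemma matching_of_chain s :
  size s = (2 * N)%N -> is_tiling_chain s -> matching s.
Proof.
move=> szs ch; have states := chain_states szs ch.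
have /chainP[step last_state] := ch.
have stepS (i : 'I_(2 * N)) := step i (eq_ind_r (fun n => i < n)%N (ltn_ord i) szs).
have source_entry p : entry s p -> val p.2 \in state (iota N M) s p.1.
  have [<- _ _ _] := stepS p.1.
  by move=> ep; apply/mem_source; exists p.2.
have target_entry p d : entry s p = Some d ->
    val (lower d p.2) \in state (iota N M) s p.1.+1.
  move=> ep; apply/mem_target; exists p.2; rewrite -/(entry s p) ep //.
  by rewrite /fall /=; case: (d).
have supp p : entry s p -> p \in inside.
  move=> /source_entry ps; have := states p.1 (val p.2) (ltnW (ltn_ord p.1)) ps.
  by rewrite inE => /andP[].
split=> // [p q _ _|i j|p pin].
- case ep: (entry s p) => [d|]; case eq: (entry s q) => [d'|] //=.
  + case=> ei ej; have ei' : p.1 = q.1 by apply: val_inj.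
    move: eq; rewrite /entry -ei' => eq.
    rewrite [p]surjective_pairing [q]surjective_pairing -ei'; congr pair.
    (* Two paths in one column: the target list is strictly increasing, so equal end heights occur
       at equal positions of the list. *)
    have [_ _ _ srt] := stepS p.1; set E := nth _ _ _ in srt.
    have /(uniqP 0%N) inj := sorted_uniq ltn_trans ltnn srt.
    pose js := [seq j <- enum 'I_(N + M) | E j].
    have pj : p.2 \in js by rewrite mem_filter mem_enum -/(entry s p) ep.
    have qj : q.2 \in js by rewrite mem_filter mem_enum eq.
    have szt : size (target E) = size js by rewrite size_map.
    have nthj j : j \in js -> nth 0%N (target E) (index j js) = (val j - fall (E j))%N.
      by move=> jj; rewrite (nth_map j) ?index_mem // nth_index.
    have := inj (index p.2 js) (index q.2 js).
    rewrite !inE szt !index_mem pj qj => /(_ isT isT).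
    rewrite !nthj // -/(entry s p) ep eq /fall => eq_idx.
    have : index p.2 js = index q.2 js.
      by apply: eq_idx; move: ej; case: (d); case: (d').
    by move=> e; rewrite -(nth_index p.2 pj) -(nth_index p.2 qj) e.
  (* A path arriving at [q] lies in the source of the next pattern, which contradicts
     [entry s q = None]. *)
  + case=> ei ej; have := target_entry _ _ ep; rewrite -/(entry s _).
    have [sq _ _ _] := stepS q.1.
    rewrite (_ : (p.1).+1 = q.1 :> nat) //.
    rewrite -sq => /mem_source[j Ej /val_inj ejj]; move: Ej.
    by rewrite ejj (_ : lower d p.2 = q.2) -/(entry s q) ?eq //; apply: val_inj.
  + case=> ei ej; have := target_entry _ _ eq.
    have [sp _ _ _] := stepS p.1.
    rewrite (_ : (q.1).+1 = p.1 :> nat) //.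
    rewrite -sp => /mem_source[j Ej /val_inj ejj]; move: Ej.
    by rewrite ejj (_ : lower d' q.2 = p.2) -/(entry s p) ?ep //; apply: val_inj.
  + case=> ei ej; rewrite [p]surjective_pairing [q]surjective_pairing ej.
    by congr pair; apply: val_inj.
- rewrite left_in_hexagon => /andP[i_gt0 rng].
  case: (boolP ((val j) \in state (iota N M) s i)) => [|notin].
    case: i i_gt0 rng => [[|i] lt_i] //= _ rng /mem_target[j0 Ej0 ej].
    have lt_i' : (i < 2 * N)%N by [].
    pose p := (Ordinal lt_i', j0); have ep : entry s p by [].
    exists p; first exact: supp.
    rewrite /mate_of; case ed: (entry s p) ep => [d|] // _.
    congr (_, _, _); apply: val_inj => //=.
    rewrite -ej (_ : nth (blank (N + M)) s i j0 = Some d); last exact: ed.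
    by rewrite /fall; case: (d).
  (* In the last column the paths occupy all heights below [M], so a left triangle without a path
     lies in an earlier column. *)
  have lt_i : (i < 2 * N)%N.
    rewrite ltn_neqAle -ltnS ltn_ord andbT; apply: contra notin => /eqP ei.
    rewrite ei -szs last_state mem_iota leq0n add0n /=.
    by move: rng; rewrite ei; set v := nat_of_ord j; rewrite -/v; lia.
  pose p := (Ordinal lt_i, j); exists p; first by rewrite inE.
  have -> : entry s p = None.
    case ep: (entry s p) => [d|] //; case/negP: notin.
    by apply: (source_entry p); rewrite ep.
  by congr (_, _, _); apply: val_inj.
case ep: (entry s p) => [d|]; rewrite left_in_hexagon /=.
  have := states p.1.+1 _ (ltn_ord p.1) (target_entry _ _ ep).
  by case/andP=> _ rng; exact: rng.
(* Only the first column could pair a right triangle with a left one outside the hexagon, but there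
   every right triangle of the hexagon starts a path. *)
move: pin; rewrite inE => rng; rewrite rng andbT lt0n; apply/negP => /eqP p0.
have /negP[] : ~~ entry s p by rewrite ep.
have [sp _ _ _] := stepS p.1; have : val p.2 \in source (nth (blank (N + M)) s p.1).
  by rewrite sp p0 /= mem_iota ltn_ord andbT; move: rng; rewrite p0 => /andP[].
by case/mem_source=> j Ej /val_inj e; move: Ej; rewrite e.
Qed.

(** Every left triangle of the hexagon has exactly one mate, so the paths arriving at a column are
    those leaving it. The hexagon has no left triangles in the first column and no right ones in the
    last, which fixes the initial and final heights. *)
Lemma chain_of_matching s :
  size s = (2 * N)%N -> matching s ->
  (forall k, (k < 2 * N)%N -> grounded (nth (blank (N + M)) s k)) ->
  (forall p, p.1 = N :> nat -> p.2 = l :> nat -> entry s p = None) ->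
  is_tiling_chain s.
Proof.
move=> szs [supp inj surj inH] gr ax.
(* Paths in one column keep their order, since equal end heights would give a left triangle two
   mates. *)
have srt k : (k < 2 * N)%N -> sorted ltn (target (nth (blank (N + M)) s k)).
  move=> ltk; pose i := Ordinal ltk; set E := nth _ _ _.
  rewrite (sorted_pairwise ltn_trans) pairwise_map.
  apply: (sub_in_pairwise (P := fun j => E j) (r := fun j j' => (j < j')%N)).
  - move=> j j' Ej Ej' ltj.
    have pin : (i, j) \in inside by apply: supp.
    have qin : (i, j') \in inside by apply: supp.
    have : mate_of (entry s (i, j)) (i, j) <> mate_of (entry s (i, j')) (i, j').
      by move/(inj _ _ pin qin) => [e]; rewrite e ltnn in ltj.
    rewrite /entry /= -/E; move: Ej Ej'; rewrite /= -!topredE /=.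
    case ed: (E j) => [d|] // _; case ed': (E j') => [d'|] // _ neq.
    have {}neq : (j - d)%N <> (j' - d')%N.
      by move=> e; apply: neq; congr (_, _, _); apply: val_inj.
    rewrite /fall; move: neq; case: (d); case: (d') => /=; lia.
  - by apply/allP => j; rewrite mem_filter => /andP[].
  - by apply: pairwise_filter; rewrite -(pairwise_map val ltn) val_enum_ord
      -(sorted_pairwise ltn_trans) iota_ltn_sorted.
have mem_target_entry (i : 'I_(2 * N)) v :
    reflect (exists2 j, entry s (i, j) & mate_of (entry s (i, j)) (i, j)
              = (false, lift ord0 i, v)) (val v \in target (nth (blank (N + M)) s i)).
  apply: (iffP (mem_target _ _)) => -[j Ej ej]; exists j => //; move: Ej ej;
    rewrite /entry /=; case: (nth (blank (N + M)) s i j) => [d|] // _.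
    by move=> ej; congr (_, _, _); apply: val_inj; rewrite /= -ej /fall; case: (d).
  by case=> <- /=; rewrite /fall; case: (d).
have target_lt E v : v \in @target (N + M) E -> (v < N + M)%N.
  by case/mem_target=> j _ <-; apply: leq_ltn_trans (ltn_ord j); apply: leq_subr.
have sourceE k : (k < 2 * N)%N ->
    source (nth (blank (N + M)) s k) = state (iota N M) s k.
  move=> ltk; apply: (irr_sorted_eq ltn_trans ltnn (sorted_source _)).
    by case: k ltk => [|k] ltk; [apply: iota_ltn_sorted|apply/srt/ltnW].
  case: k ltk => [|k] ltk v /=.
    rewrite mem_iota; apply/mem_source/andP => [[j Ej <-]|[ge_v lt_v]].
      split; last exact: ltn_ord.
      have : (Ordinal ltk, j) \in inside by apply: supp.
      by rewrite inE => /andP[].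
    pose p := (Ordinal ltk, Ordinal lt_v); exists (Ordinal lt_v) => //.
    have /inH : p \in inside by rewrite inE /=; lia.
    rewrite -[nth (blank (N + M)) s 0%N (Ordinal lt_v)]/(entry s p); case: (entry s p) => //.
    by rewrite /= left_in_hexagon.
  pose i := Ordinal ltk; pose i' := Ordinal (ltnW ltk).
  have eq_i : lift ord0 i' = widen_ord (leqnSn _) i by apply: val_inj.
  apply/mem_source/idP => [[j Ej <-]|vt].
    have pin : (i, j) \in inside by apply: supp.
    have : (false, lift ord0 i', j) \in hexagon N M.
      by rewrite left_in_hexagon; move: pin; rewrite inE.
    case/surj=> [[i0 j0] qin]; case eq: (entry s (i0, j0)) => [d|] /= [ei ej].
      apply/(mem_target_entry i'); exists j0.
        by rewrite (_ : i' = i0) ?eq //; apply: val_inj; rewrite /= -[k]/(0 + k)%N.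
      rewrite (_ : i' = i0) ?eq; last by apply: val_inj; rewrite /= -[k]/(0 + k)%N.
      by rewrite /= ej.
    have e : (i0, j0) = (i, j) by congr pair => //; apply: val_inj.
    by move: Ej; rewrite -[nth (blank (N + M)) s k.+1 j]/(entry s (i, j)) -e eq.
  have lt_v := target_lt _ _ vt; exists (Ordinal lt_v) => //.
  have /(mem_target_entry i' (Ordinal lt_v))[j0 ej0 mj0] := vt.
  have qin : (i', j0) \in inside by apply: supp.
  have := inH _ qin; rewrite mj0 left_in_hexagon => /andP[_ rng].
  have pin : (i, Ordinal lt_v) \in inside by rewrite inE.
  apply/negPn/negP.
  rewrite -[nth (blank (N + M)) s k.+1 (Ordinal lt_v)]/(entry s (i, Ordinal lt_v)) => ev.
  have : mate_of (entry s (i', j0)) (i', j0)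
       = mate_of (entry s (i, Ordinal lt_v)) (i, Ordinal lt_v).
    by rewrite mj0; case: (entry _ _) ev => // _; rewrite /= eq_i.
  by move/(inj _ _ qin pin) => [/eqP]; rewrite /= -[_ == _]/(k == k.+1) => /eqP; lia.
apply/chainP; rewrite szs; split=> [k ltk|].
  split; [exact: sourceE| |exact: gr|exact: srt].
  rewrite -sourceE //; apply/allP => v /mem_source[j Ej <-].
  apply/implyP => /eqP ek; apply/eqP => ej.
  by move: Ej; rewrite -[nth (blank (N + M)) s k j]/(entry s (Ordinal ltk, j)) ax //=; lia.
have lt_last : ((2 * N).-1 < 2 * N)%N by lia.
pose i := Ordinal lt_last.
rewrite (_ : (2 * N)%N = (2 * N).-1.+1) //=; last by lia.
apply: (irr_sorted_eq ltn_trans ltnn (srt _ lt_last) (iota_ltn_sorted _ _)) => v.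
rewrite mem_iota add0n leq0n /=; apply/idP/idP => [vt|lt_v].
  have lt_v := target_lt _ _ vt.
  have /(mem_target_entry i (Ordinal lt_v))[j0 ej0 mj0] := vt.
  have qin : (i, j0) \in inside by apply: supp.
  have := inH _ qin; rewrite mj0 left_in_hexagon /= /bump /=; lia.
have lt_v' : (v < N + M)%N by lia.
apply/(mem_target_entry i (Ordinal lt_v')).
have : (false, lift ord0 i, Ordinal lt_v') \in hexagon N M.
  by rewrite left_in_hexagon /= /bump /=; lia.
case/surj=> [[i0 j0] qin]; case eq: (entry s (i0, j0)) => [d|] /= [ei ej].
  have ei' : i = i0 by apply: val_inj; rewrite /= -[(_).-1]/(0 + (2 * N).-1)%N.
  by exists j0; rewrite ei' eq //=; congr (_, _, _); apply: val_inj.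
by have := ltn_ord i0; rewrite ei /bump /=; lia.
Qed.

(** At height 0 the truncated [lower] gives [Some false] and [Some true] the same mate; testing
    [Some false] first makes the patterns grounded. *)
Definition chain_of (T : {set {set triangle N M}}) :
    (2 * N).-tuple (pattern (N + M)) :=
  [tuple [ffun j =>
     if [set right_of (i, j); mate_of (Some false) (i, j)] \in T then Some false
     else if [set right_of (i, j); mate_of (Some true) (i, j)] \in T
     then Some true else None] | i < 2 * N].

Lemma entry_chain_of T p :
  entry (chain_of T) p =
    if [set right_of p; mate_of (Some false) p] \in T then Some false
    else if [set right_of p; mate_of (Some true) p] \in T then Some true
    else None.
Proof.
by rewrite /entry -tnth_nth tnth_mktuple ffunE -surjective_pairing.
Qed.

Lemma pair_inj p q o o' :
  [set right_of p; mate_of o p] = [set right_of q; mate_of o' q] ->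
  p = q /\ mate_of o p = mate_of o' q.
Proof.
have neq p' q' o'' : right_of p' <> mate_of o'' q'.
  by move/(congr1 (fun t => t.1.1)); rewrite mate_of_left.
move=> e; split.
  have : right_of p \in [set right_of q; mate_of o' q] by rewrite -e set21.
  by case/set2P=> [/right_of_inj|/neq].
have : mate_of o p \in [set right_of q; mate_of o' q] by rewrite -e set22.
by case/set2P=> // /esym/neq.
Qed.

Lemma mem_tiling_of s p o :
  ([set right_of p; mate_of o p] \in tiling_of s)
  = (p \in inside) && (mate_of o p == mate_of (entry s p) p).
Proof.
apply/imsetP/andP => [[q qin /pair_inj[-> /eqP->]]|[pin /eqP e]] //.
by exists p; rewrite // e.
Qed.

Lemma grounded_chain_of T k :
  (k < 2 * N)%N -> grounded (nth (blank (N + M)) (chain_of T) k).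
Proof.
move=> ltk; apply/forallP => j; apply/implyP.
rewrite -[nth (blank (N + M)) _ k j]/(entry (chain_of T) (Ordinal ltk, j)).
rewrite entry_chain_of lt0n; case: ifP => // notT; case: ifP => // inT _.
apply/negP => /eqP j0; move: notT.
rewrite (_ : mate_of _ _ = mate_of (Some true) (Ordinal ltk, j)) ?inT //.
by congr (_, _, _); apply: val_inj; rewrite /= j0.
Qed.

(** The three possible mates of a right triangle differ, except for [Some false] and [Some true] at
    height 0, where groundedness decides. *)
Lemma tiling_ofK s : size s = (2 * N)%N -> is_tiling_chain s ->
  chain_of (tiling_of s) = s :> seq _.
Proof.
move=> szs ch; have [supp _ _ _] := matching_of_chain szs ch.
have /chainP[step _] := ch.
apply: (@eq_from_nth _ (blank (N + M))) => [|i]; rewrite size_tuple // => lti.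
apply/ffunP => j; pose p := (Ordinal lti, j).
rewrite -[LHS]/(entry (chain_of (tiling_of s)) p) -[RHS]/(entry s p).
have lti' : (i < size s)%N by rewrite szs.
have [_ _ /forallP/(_ j)/implyP gr _] := step i lti'.
rewrite entry_chain_of !mem_tiling_of; case ep: (entry s p) => [d|].
  rewrite supp ?ep //; case: d ep => ep; last by rewrite eqxx.
  have j_gt0 : (0 < j)%N by apply: gr; apply/eqP.
  case: eqP => [|_]; last by rewrite eqxx.
  by case; lia.
have neq d : (mate_of (Some d) p == mate_of None p) = false.
  by apply/eqP => -[]; rewrite /bump /=; lia.
by rewrite !neq !andbF.
Qed.

Section TilingToChain.
Variable T : {set {set triangle N M}}.
Hypothesis T_tiling : rhombus_tiling T.

Let T_partition : partition T (hexagon N M).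
Proof. by case/andP: T_tiling. Qed.

(** Triangles of equal orientation share no edge, so a rhombus consists of a right triangle and one
    of its three left neighbours. *)
Lemma tiling_block r : r \in T ->
  exists2 p, p \in inside & exists2 o, r = [set right_of p; mate_of o p]
                                     & (o == Some true) ==> (0 < p.2)%N.
Proof.
move=> rT; have /andP[_ /forallP/(_ r)/implyP/(_ rT)] := T_tiling.
have {rT} sub_r t : t \in r -> t \in hexagon N M.
  by rewrite -(cover_partition T_partition) => tr; apply/bigcupP; exists r.
case/existsP=> t /existsP[u /andP[adj /eqP er]].
wlog [b eb] : t u adj er / exists b, t = (true, b.1, b.2).
  case: t adj er => [[[] i] j] adj er.
    by apply; [exact: adj|exact: er|exists (i, j)].
  case: u adj er => [[[] i'] j'] adj er; last by rewrite share_edge_same in adj.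
  apply; [|by rewrite er setUC|by exists (i', j')].
  by rewrite share_edgeC.
case: b eb => i j /= et; rewrite {t}et in adj er.
case: u adj er => [[[] i'] j'] adj er; first by rewrite share_edge_same in adj.
have [|p pin ep] := @hexagon_right i j; first by apply: sub_r; rewrite er set21.
exists p => //; rewrite er -ep.
have [ei ej] : i = p.1 :> nat /\ j = p.2 by case: ep => <- <-.
move: adj; rewrite share_edge_right => /or3P[] /andP[/eqP ei' /eqP ej'].
- exists None => //; congr [set _; (_, _, _)]; apply: val_inj => /=.
    by rewrite ei' ei.
  by rewrite ej' ej.
- exists (Some false) => //; congr [set _; (_, _, _)]; apply: val_inj => /=.
    by rewrite ei' ei.
  by rewrite ej' ej subn0.
- exists (Some true); last by rewrite -ej -ej'.
  congr [set _; (_, _, _)]; apply: val_inj => /=.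
    by rewrite ei' ei.
  by rewrite -ej -ej' subn1.
Qed.

Lemma tiling_block_eq r r' t : r \in T -> r' \in T -> t \in r -> t \in r' -> r = r'.
Proof.
case/and3P: T_partition => _ /trivIsetP triv _ rT r'T tr tr'.
apply/eqP; apply: contraTT isT => neq.
by have /pred0P/(_ t) := triv _ _ rT r'T neq; rewrite /= tr tr'.
Qed.

Lemma tiling_cover t : t \in hexagon N M -> exists2 r, r \in T & t \in r.
Proof.
rewrite -(cover_partition T_partition) => /bigcupP[r rT tr]; by exists r.
Qed.

Lemma mem_tiling_entry p : p \in inside ->
  [set right_of p; mate_of (entry (chain_of T) p) p] \in T.
Proof.
rewrite -right_of_hexagon => /tiling_cover[r rT pr].
have [q _ [o er _]] := tiling_block rT.
have epq : p = q.
  move: pr; rewrite er => /set2P[/right_of_inj //|].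
  by move/(congr1 (fun t => t.1.1)); rewrite mate_of_left.
rewrite entry_chain_of; case: ifP => // notF; case: ifP => // notT.
move: rT; rewrite {r pr}er -{q}epq; case: o => [[]|] //.
  by rewrite notT.
by rewrite notF.
Qed.

Lemma entry_chain_of_inside p : entry (chain_of T) p -> p \in inside.
Proof.
have sub r : r \in T -> right_of p \in r -> p \in inside.
  move=> rT pr; rewrite -right_of_hexagon -(cover_partition T_partition).
  by apply/bigcupP; exists r.
by rewrite entry_chain_of; case: ifP => [/sub-> //|_]; rewrite ?set21 //;
  case: ifP => // /sub-> //; rewrite set21.
Qed.

Lemma matching_chain_of : matching (chain_of T).
Proof.
split=> [p|p q pin qin|i j jH|p pin].
- exact: entry_chain_of_inside.
- have pT := mem_tiling_entry pin; have qT := mem_tiling_entry qin.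
  move=> e; have pq : mate_of (entry (chain_of T) p) p
      \in [set right_of q; mate_of (entry (chain_of T) q) q].
    by apply/set2P; right.
  by case/pair_inj: (tiling_block_eq pT qT (set22 _ _) pq).
- have [r rT jr] := tiling_cover jH.
  have [p pin [o er _]] := tiling_block rT.
  exists p => //; have pT := mem_tiling_entry pin.
  have : r = [set right_of p; mate_of (entry (chain_of T) p) p].
    by apply: (tiling_block_eq rT pT (t := right_of p)); rewrite ?er set21.
  by move=> er'; move: jr; rewrite er' => /set2P[|].
rewrite -(cover_partition T_partition); apply/bigcupP.
by exists [set right_of p; mate_of (entry (chain_of T) p) p];
  rewrite ?set22 // mem_tiling_entry.
Qed.

Lemma chain_ofK : tiling_of (chain_of T) = T.
Proof.
apply/setP => r; apply/imsetP/idP => [[p pin ->]|rT].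
  exact: mem_tiling_entry.
have [p pin [o er _]] := tiling_block rT; exists p => //.
apply: (tiling_block_eq rT (mem_tiling_entry pin) (t := right_of p)).
  by rewrite er set21.
by rewrite set21.
Qed.

End TilingToChain.

(** Column [i] has first coordinate [i - N], so column [N] is the axis. The axis rhombus is a pair
    across a vertical edge, hence an entry [None]. *)
Let axis_pos : 'I_(2 * N) * 'I_(N + M) :=
  (Ordinal (ltn_Pmull (isT : 1 < 2)%N N_gt0), Ordinal l_lt).

Lemma axis_rhombusE :
  axis_rhombus N M l = [set right_of axis_pos; mate_of None axis_pos].
Proof.
apply/setP => -[[b i] j]; rewrite !inE /= !xpair_eqE.
rewrite -!(inj_eq val_inj) /=; case: b => /=; rewrite !inE !xpair_eqE /=.
  by decide_int_equalities; lia.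
by decide_int_equalities; lia.
Qed.

(** [tiling_of] maps the chains bijectively onto these tilings, with inverse [chain_of]; no path at
    height [l] on the axis means entry [None] at [axis_pos]. *)
Theorem card_tilings_axis :
  #|[set T : {set {set triangle N M}} |
      rhombus_tiling T & axis_rhombus N M l \in T]|
  = #|[set s : (2 * N).-tuple (pattern (N + M)) | is_tiling_chain s]|.
Proof.
have axis_in : axis_pos \in inside by rewrite inE /=; lia.
have -> : [set T : {set {set triangle N M}} |
      rhombus_tiling T & axis_rhombus N M l \in T]
   = (fun s : (2 * N).-tuple _ => tiling_of s) @:
      [set s : (2 * N).-tuple (pattern (N + M)) | is_tiling_chain s].
  apply/setP => T; rewrite inE axis_rhombusE; apply/andP/imsetP => [[tT axT]|[s]].
    exists (chain_of T); last by rewrite chain_ofK.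
    rewrite inE; apply: chain_of_matching; first by rewrite size_tuple.
    - exact: matching_chain_of.
    - by move=> k; apply: grounded_chain_of.
    move=> p p1 p2; have -> : p = axis_pos.
      by rewrite [p]surjective_pairing; congr pair; apply: val_inj.
    move: axT; rewrite -{1}(chain_ofK tT) mem_tiling_of axis_in /=.
    by case: (entry _ _) => [d|] // /eqP[]; rewrite /bump /=; lia.
  rewrite inE => ch ->; have szs := size_tuple s; split.
    apply/andP; split; first by apply/partition_matching/matching_of_chain.
    apply/forallP => r; apply/implyP => /imsetP[p pin ->].
    apply: is_rhombus_pair; apply/implyP => ep.
    have /chainP[step _] := ch; rewrite szs in step.
    by have [_ _ /forallP/(_ p.2)/implyP gr _] := step _ (ltn_ord p.1); apply: gr.
  rewrite mem_tiling_of axis_in /=.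
  suff -> : entry s axis_pos = None by [].
  case ep: (entry s axis_pos) => [d|] //.
  have /chainP[step _] := ch; rewrite szs in step.
  have [se /allP al _ _] := step _ (ltn_ord axis_pos.1).
  have : l \in source (nth (blank (N + M)) s axis_pos.1).
    by apply/mem_source; exists axis_pos.2; rewrite // -/(entry s axis_pos) ep.
  by rewrite se => /al; rewrite /avoids_axis /= eqxx implybF; lia.
rewrite card_in_imset // => s s'; rewrite !inE => ch ch' e.
apply: val_inj; rewrite /= -(tiling_ofK (size_tuple s) ch).
by rewrite -(tiling_ofK (size_tuple s') ch') e.
Qed.

End TilingsAsChains.

(** * Gram determinant with a deleted column *)

(** Unrestricted paths choose which [r - j] of the [k] steps drop; without the guard, truncated
    subtraction would give 1 for [j > r]. *)
Definition free_paths (k r j : nat) : rat :=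
  if (j <= r)%N then 'C(k, r - j)%:R else 0.

Lemma free_paths0 (r j : nat) : free_paths 0 r j = (r == j)%:R.
Proof.
rewrite /free_paths bin0n subn_eq0 eqn_leq.
by case: (j <= r)%N; rewrite ?andbT ?andbF.
Qed.

Lemma free_pathsS (k r j : nat) :
  free_paths k.+1 r j = free_paths k r j + (0 < r)%N%:R * free_paths k r.-1 j.
Proof.
rewrite /free_paths; case: r => [|r] /=.
  by rewrite mul0r addr0; case: j => [|j] //=; rewrite !bin0.
rewrite mul1r; case: (ltngtP j r.+1) => [lt|lt|->].
- by rewrite -ltnS lt subSn -1?ltnS // binS natrD.
- by rewrite leqNgt (ltnW lt) addr0.
- by rewrite subnn !bin0 ltnn addr0.
Qed.

Lemma path_count_free (N l k r j : nat) :
  (k < N)%N -> path_count (avoids_axis N l) k r j = free_paths k r j.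
Proof.
elim: k r => [|k IHk] r ltk; first by rewrite free_paths0.
have neq : (k.+1 == N) = false by apply/eqP; lia.
rewrite /= {1}/avoids_axis neq /= mul1r (IHk _ (ltnW ltk)) (IHk _ (ltnW ltk)).
by rewrite free_pathsS.
Qed.

(** Cutting the paths where [N] steps remain turns the forbidden height into a deleted summand.
    Heights never rise, so the range below [K] contains all of them. *)
Lemma path_count_avoids (N l K k r j : nat) :
  (0 < N)%N -> (r < K)%N ->
  path_count (avoids_axis N l) (k + N) r j
  = \sum_(v < K) free_paths k r v * ((v != l :> nat)%:R * free_paths N v j).
Proof.
move=> N_gt0; elim: k r => [|k IHk] r ltr.
  rewrite (bigD1 (Ordinal ltr)) //= free_paths0 eqxx mul1r big1 ?addr0 => [|v neq].
    case: N N_gt0 => // N _.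
    by rewrite add0n /= {1}/avoids_axis eqxx /= !path_count_free // free_pathsS.
  rewrite free_paths0 (_ : (r == v :> nat) = false) ?mul0r //.
  by apply: contraNF neq => /eqP e; apply/eqP/val_inj.
have neq : ((k + N).+1 == N) = false by apply/eqP; lia.
rewrite addSn /= {1}/avoids_axis neq /= mul1r.
rewrite !IHk //; last by apply: leq_ltn_trans (leq_pred _) ltr.
rewrite mulr_sumr -big_split /=; apply: eq_bigr => v _.
by rewrite free_pathsS mulrDl !mulrA.
Qed.

(** Symmetry of the binomials. It makes the counts on the two sides of the axis transposes of each
    other, so that their product is a Gram matrix. *)
Lemma free_pathsN (N i v : nat) : free_paths N (N + i) v = free_paths N v i.
Proof.
rewrite /free_paths; case: (leqP v (N + i)) => [le|lt]; last first.
  rewrite bin_small ?if_same //; lia.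
case: (leqP i v) => [le'|lt]; last by rewrite bin_small //; lia.
rewrite -bin_sub; last by lia.
by congr ('C(N, _)%:R); lia.
Qed.

(** The block matrix with identity diagonal blocks and off-diagonal blocks [u], [v] is eliminated in
    both orders. *)
Lemma det_mx1_sub_rank1 (R : comNzRingType) (n : nat) (u : 'cV[R]_n) (v : 'rV[R]_n) :
  \det (1%:M - u *m v) = 1 - (v *m u) 0 0.
Proof.
have e1 : block_mx 1%:M u v 1%:M
    = block_mx 1%:M 0 v 1%:M *m block_mx 1%:M u 0 (1%:M - v *m u).
  rewrite mulmx_block !mul1mx !mulmx0 !mul0mx !mulmx1 !addr0.
  by rewrite [v *m u + _]addrC subrK.
have e2 : block_mx 1%:M u v 1%:M
    = block_mx (1%:M - u *m v) u 0 1%:M *m block_mx 1%:M 0 v 1%:M.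
  rewrite mulmx_block !mulmx1 !mul1mx !mul0mx !mulmx0 !add0r.
  by rewrite subrK.
have := congr1 determinant e1; rewrite e2 !det_mulmx !det_lblock !det_ublock !det1 !mulr1 !mul1r.
by move=> ->; rewrite det_mx11 !mxE.
Qed.

Section DeletedColumn.
Variables (F : fieldType) (M N : nat) (A : 'M[F]_(M, N + M)) (P : 'M[F]_(N, N + M)).
Variable (h : 'rV[F]_N).
Hypotheses (h_neq0 : forall k, h 0 k != 0) (AP0 : P *m A^T = 0).
Hypothesis PP : P *m P^T = diag_mx h.
Hypothesis G_unit : A *m A^T \in unitmx.

(** The row spaces of [P] and [A] are orthogonal complements, so their two orthogonal projections
    add up to the identity. Formally, a right inverse of the square matrix [col_mx P A] is also a
    left inverse. *)
Lemma completeness :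
  P^T *m diag_mx (\row_k (h 0 k)^-1) *m P + A^T *m invmx (A *m A^T) *m A = 1%:M.
Proof.
set H' := diag_mx _; set G := A *m A^T.
have PA0 : A *m P^T = 0 by apply: trmx_inj; rewrite trmx_mul trmxK AP0 trmx0.
have HH' : diag_mx h *m H' = 1%:M.
  rewrite mulmx_diag; apply/matrixP => i j; rewrite !mxE.
  by rewrite divff.
have inv : col_mx P A *m (row_mx P^T A^T *m block_mx H' 0 0 (invmx G)) = 1%:M.
  rewrite mulmxA mul_col_row PP AP0 PA0 mulmx_block !mul0mx !mulmx0 !addr0 !add0r.
  by rewrite HH' mulmxV // -scalar_mx_block.
by move/mulmx1C: inv; rewrite mul_row_block !mulmx0 addr0 add0r mul_row_col.
Qed.

(** Deleting a column is a rank-one change of the Gram matrix. It multiplies the determinant by 1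
    minus the diagonal entry at [l] of the projection onto the rows of [A], which is the entry of
    the complementary projection. *)
Lemma det_gram_deleted (l : 'I_(N + M)) :
  \det (\matrix_(i, j) \sum_v (v != l)%:R * A i v * A j v)
  = \det (A *m A^T) * \sum_k P k l ^+ 2 / h 0 k.
Proof.
set G := A *m A^T.
have -> : \matrix_(i, j) \sum_v (v != l)%:R * A i v * A j v
   = G *m (1%:M - (invmx G *m col l A) *m (col l A)^T).
  rewrite mulmxBr mulmx1 !mulmxA mulmxV // mul1mx.
  apply/matrixP => i j; rewrite !mxE big_ord1 !mxE.
  rewrite (bigD1 l) //= eqxx !mul0r add0r [X in _ = X - _](bigD1 l) //= !mxE.
  rewrite addrAC subrr add0r; apply: eq_bigr => v neq.
  by rewrite neq mul1r !mxE.
rewrite det_mulmx det_mx1_sub_rank1; congr (_ * _).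
have /matrixP/(_ l l) := completeness.
rewrite [LHS]mxE [RHS]mxE eqxx mulr1n => <-.
have -> : ((col l A)^T *m (invmx G *m col l A)) 0 0
   = (A^T *m invmx (A *m A^T) *m A) l l.
  rewrite mulmxA !mxE; apply: eq_bigr => i _; rewrite !mxE; congr (_ * _).
  by apply: eq_bigr => j _; rewrite !mxE.
rewrite addrK mxE; apply: eq_bigr => k _; rewrite mul_mx_diag !mxE expr2.
by rewrite mulrAC.
Qed.

(** With [Q = col_mx P A], the product of [Q] and its transpose is block diagonal, and that of [Q]
    and the transpose of [col_mx E A] is block triangular; squaring the second relation eliminates
    the determinant of [Q]. *)
Lemma det_gram_lower (E : 'M[F]_(N, N + M)) :
  \det (col_mx E A) ^+ 2 = 1 -> \det (P *m E^T) != 0 ->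
  \det (A *m A^T) = (\prod_k h 0 k) / \det (P *m E^T) ^+ 2.
Proof.
set G := A *m A^T; move=> E1 V0.
have PA0 : A *m P^T = 0 by apply: trmx_inj; rewrite trmx_mul trmxK AP0 trmx0.
have e1 : \det (col_mx P A) ^+ 2 = (\prod_k h 0 k) * \det G.
  rewrite expr2 -[X in _ * X]det_tr -det_mulmx tr_col_mx mul_col_row AP0 PA0 PP det_lblock.
  by rewrite det_diag.
have e2 : \det (col_mx P A) * \det (col_mx E A) = \det (P *m E^T) * \det G.
  by rewrite -[\det (col_mx E A)]det_tr -det_mulmx tr_col_mx mul_col_row AP0 det_lblock.
have G0 : \det G != 0 by rewrite -unitfE -unitmxE.
apply: (canRL (mulfK _)); first by rewrite expf_neq0.
apply: (mulIf G0); rewrite -e1 -[RHS]mulr1 -E1 -exprMn e2; ring.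
Qed.

End DeletedColumn.

(** If [x] annihilates the Gram matrix, then [x *m A] has squared length 0. *)
Lemma gram_unitmx (F : realFieldType) (m n : nat) (A : 'M[F]_(m, n)) :
  row_free A -> A *m A^T \in unitmx.
Proof.
move=> freeA; rewrite -row_free_unit; apply: inj_row_free => x xG.
suff xA : x *m A = 0 by apply: (row_free_inj freeA); rewrite xA mul0mx.
have : ((x *m A) *m (x *m A)^T) 0 0 = 0.
  by rewrite trmx_mul mulmxA -[x *m A *m _]mulmxA xG mul0mx mxE.
rewrite mxE => /eqP; rewrite psumr_eq0 => [/allP z|j _]; last first.
  by rewrite [_^T _ _]mxE -expr2 sqr_ge0.
apply/rowP => j; have := z j (mem_index_enum _).
by rewrite [_^T _ _]mxE -expr2 sqrf_eq0 [RHS]mxE => /eqP.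
Qed.

(** * Finite differences and determinants of polynomial values *)

Lemma size_shift_sub (R : idomainType) (p : {poly R}) :
  (size (p \Po ('X + 1) - p)%R <= (size p).-1)%N.
Proof.
elim/poly_ind: p => [|p c IHp]; first by rewrite comp_poly0 subrr size_poly0.
rewrite comp_polyD comp_polyM comp_polyX comp_polyC.
set q := p \Po _ in IHp *.
have -> : q * ('X + 1) + c%:P - (p * 'X + c%:P) = (q - p) * ('X + 1) + p by ring.
have [p0|p_neq0] := eqVneq p 0.
  by rewrite /q p0 comp_poly0 subrr mul0r addr0 size_poly0.
rewrite size_MXaddC (negbTE p_neq0) /= (leq_trans (size_polyD _ _)) // geq_max leqnn andbT.
rewrite (leq_trans (size_polyMleq _ _)) // -polyC1 size_XaddC addn2 /=.
by rewrite (leq_ltn_trans IHp) // prednK // size_poly_gt0.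
Qed.

Lemma alternating_sumS (R : nzRingType) (N : nat) (f : nat -> R) :
  \sum_(k < N.+2) (-1) ^+ k * 'C(N.+1, k)%:R * f k
  = \sum_(k < N.+1) (-1) ^+ k * 'C(N, k)%:R * (f k - f k.+1).
Proof.
rewrite big_ord_recl /= bin0.
under eq_bigr => k _ do rewrite binS natrD mulrDr mulrDl.
rewrite big_split /= addrA.
have -> : (-1) ^+ 0 * 1%:R * f 0%N
    + \sum_(k < N.+1) (-1) ^+ bump 0 k * 'C(N, k.+1)%:R * f (bump 0 k)
  = \sum_(k < N.+1) (-1) ^+ k * 'C(N, k)%:R * f k.
  pose g k := (-1) ^+ k * 'C(N, k)%:R * f k.
  transitivity (\sum_(k < N.+2) g k); first by rewrite [RHS]big_ord_recl /g /= ?bin0.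
  by rewrite big_ord_recr /= {2}/g bin_small // mulr0 mul0r addr0.
rewrite -big_split /=; apply: eq_bigr => k _.
by rewrite /bump /= add1n exprS mulN1r !mulNr mulrBr.
Qed.

(** By Pascal's rule a difference of order [N + 1] is one of order [N] applied to a first
    difference, which has lower degree. *)
Lemma alternating_sum_poly (R : idomainType) (N : nat) (p : {poly R}) (x : R) :
  (size p <= N)%N -> \sum_(k < N.+1) (-1) ^+ k * 'C(N, k)%:R * p.[x + k%:R] = 0.
Proof.
elim: N p x => [|N IHN] p x szp.
  by move: szp; rewrite size_poly_leq0 => /eqP->; rewrite big_ord1 horner0 mulr0.
rewrite (alternating_sumS _ (fun k => p.[x + k%:R])).
have szq : (size (p \Po ('X + 1) - p)%R <= N)%N.
  by apply: (leq_trans (size_shift_sub p)); case: (size p) szp.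
transitivity (- \sum_(k < N.+1) (-1) ^+ k * 'C(N, k)%:R
    * (p \Po ('X + 1) - p).[x + k%:R]); last by rewrite IHN // oppr0.
rewrite -sumrN; apply: eq_bigr => k _.
rewrite -mulrN hornerD hornerN horner_comp opprB !hornerE.
by rewrite -addrA -natr1.
Qed.

(** The matrix is a unitriangular coefficient matrix times a Vandermonde matrix. *)
Lemma det_monic_values (R : comNzRingType) (N : nat) (p : nat -> {poly R}) (x : 'I_N -> R) :
  (forall k, size (p k) = k.+1) -> (forall k, p k \is monic) ->
  \det (\matrix_(k < N, v < N) (p k).[x v])
  = \prod_(i < N) \prod_(j < N | (i < j)%N) (x j - x i).
Proof.
move=> szp mp.
have -> : \matrix_(k < N, v < N) (p k).[x v]
    = \matrix_(k < N, j < N) (p k)`_j *m Vandermonde N (\row_v x v).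
  apply/matrixP => k v; rewrite !mxE horner_coef szp.
  rewrite (big_ord_widen N (fun j => (p k)`_j * x v ^+ j)) // big_mkcond /=.
  apply: eq_bigr => j _; rewrite !mxE; case: ifP => // /negbT.
  by rewrite -leqNgt => le; rewrite nth_default ?mul0r // szp.
rewrite det_mulmx det_Vandermonde det_trig; last first.
  by apply/is_trig_mxP => i j lt; rewrite mxE nth_default // szp.
rewrite big1 ?mul1r => [|i _]; last first.
  by rewrite mxE; have /monicP := mp i; rewrite /lead_coef szp.
by apply: eq_bigr => i _; apply: eq_bigr => j _; rewrite !mxE.
Qed.

Lemma prod_differences (R : comNzRingType) (N : nat) :
  \prod_(i < N) \prod_(j < N | (i < j)%N) (j%:R - i%:R) = \prod_(k < N) k`!%:R :> R.
Proof.
rewrite (exchange_big_dep xpredT) //=; apply: eq_bigr => j _.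
rewrite -(big_ord_widen N (fun i => j%:R - i%:R)); last by apply: ltnW.
elim: (val j) => [|k IHk]; first by rewrite big_ord0.
rewrite big_ord_recl subr0 factS natrM -IHk; congr (_ * _).
by apply: eq_bigr => i _; rewrite /bump /= -natr1 -[(1 + i)%:R]natr1; ring.
Qed.

Section ChainDeterminant.
Variables (N M l : nat) (p : nat -> {poly rat}) (h : nat -> rat).
Hypotheses (N_gt0 : (0 < N)%N) (l_lt : (l < N + M)%N).
Hypotheses (size_p : forall k, size (p k) = k.+1) (monic_p : forall k, p k \is monic).
Hypothesis h_neq0 : forall k, (k < N)%N -> h k != 0.
Hypothesis orthogonal_p : forall j k, (j < N)%N -> (k < N)%N ->
  \sum_(v < N + M) (p j).[v%:R] * (p k).[v%:R] = h k *+ (j == k).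

(** The sign turns each row into an [N]-th difference and cancels in the Gram matrix. *)
Let A : 'M[rat]_(M, N + M) := \matrix_(i, v) ((-1) ^+ v * free_paths N (N + i) v).
Let P : 'M[rat]_(N, N + M) := \matrix_(k, v) (p k).[v%:R].
(** The first [N] unit vectors complete [A] to a triangular matrix with diagonal entries 1 and
    -1. *)
Let E : 'M[rat]_(N, N + M) := \matrix_(k, v) (v == lshift M k)%:R.

Let PA0 : P *m A^T = 0.
Proof.
apply/matrixP => k j; rewrite !mxE.
under eq_bigr => v _ do rewrite !mxE free_pathsN.
pose F v : rat := (p k).[v%:R] * ((-1) ^+ v * free_paths N v j).
(* Only heights from [j] to [j + N] carry a nonzero binomial; on this range the sum is an [N]-th
   difference up to the sign of [(-1) ^+ j]. *)
rewrite -(big_mkord xpredT F) (big_cat_nat (n := j)) //=; last first.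
  by rewrite ltnW // (leq_trans (ltn_ord j)) ?leq_addl.
rewrite big_nat big1 ?add0r => [|v /andP[_ lt]]; last first.
  by rewrite /F /free_paths leqNgt lt !mulr0.
have le_jN : (j + N.+1 <= N + M)%N by have := ltn_ord j; lia.
rewrite (big_cat_nat (n := (j + N.+1)%N)) ?leq_addr //=.
rewrite [X in _ + X]big_nat [X in _ + X]big1 ?addr0 => [|v /andP[ge _]]; last first.
  by rewrite /F /free_paths bin_small ?if_same ?mulr0 //; lia.
rewrite -{1}[val j]add0n big_addn addKn big_mkord.
have szk : (size (p k) <= N)%N by rewrite size_p.
have := alternating_sum_poly (j%:R) szk.
move/(congr1 (fun x => (-1) ^+ j * x)); rewrite mulr0 => e0.
apply: etrans e0; rewrite mulr_sumr; apply: eq_bigr => t _.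
rewrite /F /free_paths leq_addl addnK exprD addnC natrD; ring.
Qed.

Let PP : P *m P^T = diag_mx (\row_k h k).
Proof.
apply/matrixP => j k; rewrite !mxE.
under eq_bigr => v _ do rewrite !mxE.
by rewrite orthogonal_p // eq_sym -val_eqE eq_sym; case: eqP => [->|].
Qed.

Let det_lower : \det (col_mx E A) ^+ 2 = 1.
Proof.
rewrite det_trig; last first.
  apply/is_trig_mxP => i j; rewrite mxE; case: splitP => k ik lt_ij; rewrite mxE.
    by case: eqP => // jk; move: lt_ij; rewrite ik jk /= ltnn.
  by rewrite /free_paths leqNgt -ik lt_ij /= mulr0.
rewrite -prodrXl big1 // => i _; rewrite mxE; case: splitP => k ik; rewrite mxE.
  by rewrite -val_eqE /= ik eqxx expr1n.
by rewrite /free_paths ik leqnn subnn bin0 mulr1 -exprM mulnC exprM sqrrN expr1n.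
Qed.

Let A_free : row_free A.
Proof.
apply: inj_row_free => x xA.
have unitB : row_free (col_mx E A).
  by rewrite row_free_unit unitmxE unitfE -sqrf_eq0 det_lower oner_eq0.
have : row_mx 0 x *m col_mx E A = 0 by rewrite mul_row_col mul0mx add0r.
rewrite -(mul0mx _ (col_mx E A)) => /(row_free_inj unitB).
by rewrite -row_mx0 => /eq_row_mx[].
Qed.

Let det_PE : \det (P *m E^T) = \prod_(k < N) k`!%:R.
Proof.
rewrite -prod_differences -(det_monic_values (fun v => v%:R) size_p monic_p).
congr (\det _); apply/matrixP => k v; rewrite !mxE.
rewrite (bigD1 (lshift M v)) //= !mxE eqxx mulr1 big1 ?addr0 // => w neq.
by rewrite !mxE (negbTE neq) mulr0.
Qed.

Theorem det_path_count :
  \det (\matrix_(i < M, j < M) path_count (avoids_axis N l) (2 * N) (N + i) j)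
  = (\prod_(k < N) (h k / k`!%:R ^+ 2)) * \sum_(k < N) (p k).[l%:R] ^+ 2 / h k.
Proof.
have row_h (k : 'I_N) : (\row_(k' < N) h k') 0 k != 0 by rewrite mxE h_neq0.
have := det_gram_deleted row_h PA0 PP (gram_unitmx A_free) (Ordinal l_lt).
rewrite (det_gram_lower PA0 PP (gram_unitmx A_free) det_lower); last first.
  rewrite det_PE; apply/prodf_neq0 => k _.
  by rewrite pnatr_eq0 -lt0n fact_gt0.
rewrite det_PE -prodrXl -prodf_div.
under eq_bigr do rewrite mxE.
under [X in _ = _ * X]eq_bigr do rewrite !mxE.
move=> <-; congr (\det _); apply/matrixP => i j; rewrite !mxE mul2n -addnn.
rewrite (path_count_avoids _ (K := N + M)) ?ltn_add2l //.
apply: eq_bigr => v _; rewrite !mxE [free_paths N (N + j) v]free_pathsN -val_eqE /=.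
have sign2 : (-1) ^+ v * (-1) ^+ v = 1 :> rat.
  by rewrite -expr2 -exprM mulnC exprM sqrrN !expr1n.
transitivity ((-1) ^+ v * (-1) ^+ v
    * (free_paths N (N + i) v * ((v != l :> nat)%:R * free_paths N v j))); last by ring.
by rewrite sign2 mul1r.
Qed.

End ChainDeterminant.

(** * Discrete Chebyshev polynomials *)

(** The three-term recurrence coefficients of the monic discrete Chebyshev (Gram) polynomials on 0,
    ..., [L - 1]. *)
Definition cheb_coef (L k : nat) : rat :=
  k%:R ^+ 2 * (L%:R ^+ 2 - k%:R ^+ 2) / (4 * (4 * k%:R ^+ 2 - 1)).

Definition centre (L : nat) : rat := (L%:R - 1) / 2.

Fixpoint cheb (L k : nat) : {poly rat} :=
  if k is k'.+1 then
    if k' is k''.+1 then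
      ('X - (centre L)%:P) * cheb L k' - cheb_coef L k' *: cheb L k''
    else 'X - (centre L)%:P
  else 1.

Fixpoint cheb_norm (L k : nat) : rat :=
  if k is k'.+1 then cheb_coef L k * cheb_norm L k' else L%:R.

Lemma chebSS (L k : nat) :
  cheb L k.+2 = ('X - (centre L)%:P) * cheb L k.+1 - cheb_coef L k.+1 *: cheb L k.
Proof. by []. Qed.

Lemma horner_chebSS (L k : nat) (x : rat) :
  (cheb L k.+2).[x]
  = (x - centre L) * (cheb L k.+1).[x] - cheb_coef L k.+1 * (cheb L k).[x].
Proof. by rewrite chebSS !hornerE. Qed.

Lemma cheb_monic_size (L k : nat) : (cheb L k \is monic) * (size (cheb L k) = k.+1).
Proof.
suff [] : ((cheb L k \is monic) * (size (cheb L k) = k.+1))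
   /\ ((cheb L k.+1 \is monic) * (size (cheb L k.+1) = k.+2)) by [].
elim: k => [|k [IH0 IH1]].
  by split; split; rewrite ?monic1 ?size_poly1 ?monicXsubC ?size_XsubC.
split=> //; rewrite chebSS; set q := _ * _.
have qm : q \is monic by rewrite monicMl ?monicXsubC ?IH1.
have szq : size q = k.+3.
  by rewrite size_Mmonic ?IH1 ?size_XsubC // monic_neq0 // monicXsubC.
have lt : (size (- (cheb_coef L k.+1 *: cheb L k)) < size q)%N.
  by rewrite size_polyN szq (leq_ltn_trans (size_scale_leq _ _)) // IH0.
by split; rewrite ?monicE ?lead_coefDl ?size_polyDl.
Qed.

Section DifferenceEquation.
Variables (L : nat) (x : rat).

Let up : rat := (x + 1) * (x + 1 - L%:R).
Let down : rat := x * (x - L%:R).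
Let c := centre L.
Let p (k : nat) (y : rat) := (cheb L k).[y].

(* With T the difference operator of the third relation and X = x - c, the left
   side of the first one is the commutator [T, X]; the induction works because
   [[T, X], X] = T + (up + down). *)
Lemma cheb_difference_aux (k : nat) :
  [/\ up * p k (x + 1) - down * p k (x - 1)
      = (4 * k%:R + 2) * p k.+1 x - 2 * k%:R * (x - c) * p k x,
      up * p k.+1 (x + 1) - down * p k.+1 (x - 1)
      = (4 * k%:R + 6) * p k.+2 x - 2 * (k%:R + 1) * (x - c) * p k.+1 x,
      up * (p k (x + 1) - p k x) + down * (p k (x - 1) - p k x)
      = k%:R * (k%:R + 1) * p k x &
      up * (p k.+1 (x + 1) - p k.+1 x) + down * (p k.+1 (x - 1) - p k.+1 x)
      = (k%:R + 1) * (k%:R + 2) * p k.+1 x].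
Proof.
have pSS k' y : p k'.+2 y = (y - c) * p k'.+1 y - cheb_coef L k'.+1 * p k' y.
  by apply: horner_chebSS.
have kk (k' : nat) : 4 * (k'%:R + 1) ^+ 2 - 1 != 0 :> rat.
  have : 0 <= k'%:R :> rat by []. nra.
elim: k => [|k [Y0 Y1 E0 E1]].
  rewrite !pSS /p /= !hornerE /cheb_coef /up /down /c /centre; by split; field.
have n1 : (k.+1)%:R = k%:R + 1 :> rat by rewrite -natr1.
have YSS : up * p k.+2 (x + 1) - down * p k.+2 (x - 1)
    = (4 * k%:R + 10) * p k.+3 x - 2 * (k%:R + 2) * (x - c) * p k.+2 x.
  have -> : up * p k.+2 (x + 1) - down * p k.+2 (x - 1)
     = (x - c) * (up * p k.+1 (x + 1) - down * p k.+1 (x - 1))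
       + (up * (p k.+1 (x + 1) - p k.+1 x) + down * (p k.+1 (x - 1) - p k.+1 x)
          + (up + down) * p k.+1 x)
       - cheb_coef L k.+1 * (up * p k (x + 1) - down * p k (x - 1)).
    by rewrite !pSS; ring.
  rewrite Y0 Y1 E1 [p k.+3 x]pSS [p k.+2 x]pSS /cheb_coef -!natr1 /up /down /c /centre.
  have := kk k.+1; rewrite -!natr1 => kk1; have := kk k => kk0.
  by field; rewrite kk0 kk1.
split=> //.
- by rewrite Y1 n1; ring.
- by rewrite YSS n1; ring.
- by rewrite E1 n1; ring.
rewrite n1.
have -> : up * (p k.+2 (x + 1) - p k.+2 x) + down * (p k.+2 (x - 1) - p k.+2 x)
   = (x - c) * (up * (p k.+1 (x + 1) - p k.+1 x) + down * (p k.+1 (x - 1) - p k.+1 x))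
     + (up * p k.+1 (x + 1) - down * p k.+1 (x - 1))
     - cheb_coef L k.+1 * (up * (p k (x + 1) - p k x) + down * (p k (x - 1) - p k x)).
  by rewrite !pSS; ring.
by rewrite E1 Y1 E0 !pSS; ring.
Qed.

Lemma cheb_difference (k : nat) :
  up * (p k (x + 1) - p k x) + down * (p k (x - 1) - p k x)
  = k%:R * (k%:R + 1) * p k x.
Proof. by case: (cheb_difference_aux k). Qed.

End DifferenceEquation.

Definition cheb_dot (L : nat) (p q : {poly rat}) : rat :=
  \sum_(v < L) p.[v%:R] * q.[v%:R].

(** Eigenfunctions of a symmetric difference operator with distinct eigenvalues are orthogonal; the
    boundary terms vanish because of the factor [v * (v - L)]. *)
Lemma cheb_dot_neq (L j k : nat) : j != k -> cheb_dot L (cheb L j) (cheb L k) = 0.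
Proof.
move=> neq; have lam : j%:R * (j%:R + 1) - k%:R * (k%:R + 1) != 0 :> rat.
  have -> : j%:R * (j%:R + 1) - k%:R * (k%:R + 1)
      = (j%:R - k%:R) * (j%:R + k%:R + 1) :> rat by ring.
  by rewrite mulf_neq0 ?subr_eq0 ?eqr_nat // -natrD natr1 pnatr_eq0.
apply: (mulfI lam); rewrite mulr0 /cheb_dot mulr_sumr.
(* discrete Wronskian *)
pose V (v : nat) : rat := v%:R * (v%:R - L%:R)
  * ((cheb L j).[v%:R] * (cheb L k).[v%:R - 1]
     - (cheb L j).[v%:R - 1] * (cheb L k).[v%:R]).
transitivity (\sum_(0 <= v < L) (V v.+1 - V v)); last first.
  by rewrite telescope_sumr // /V subrr mulr0 !mul0r subr0.
rewrite big_mkord; apply: eq_bigr => v _.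
rewrite mulrBl !mulrA -(cheb_difference L v%:R j).
have -> : k%:R * (k%:R + 1) * (cheb L j).[v%:R] * (cheb L k).[v%:R]
  = (cheb L j).[v%:R] * (k%:R * (k%:R + 1) * (cheb L k).[v%:R]) by ring.
by rewrite -(cheb_difference L v%:R k) /V -natr1 addrK; ring.
Qed.

(** Moving the factor [X - centre] from one argument to the other leaves, by orthogonality, only the
    recurrence coefficient times the previous norm. *)
Lemma cheb_dot_self (L k : nat) : cheb_dot L (cheb L k) (cheb L k) = cheb_norm L k.
Proof.
elim: k => [|k IHk].
  by rewrite /cheb_dot; under eq_bigr do rewrite !hornerE; rewrite sumr_const card_ord.
have dotX p q : cheb_dot L (('X - (centre L)%:P) * p) q
    = cheb_dot L p (('X - (centre L)%:P) * q).
  by apply: eq_bigr => v _; rewrite !hornerM hornerXsubC; ring.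
have dotBl p q r a : cheb_dot L (p - a *: q) r = cheb_dot L p r - a * cheb_dot L q r.
  rewrite /cheb_dot mulr_sumr -sumrB; apply: eq_bigr => v _.
  by rewrite hornerD hornerN hornerZ; ring.
have dotC p q : cheb_dot L p q = cheb_dot L q p.
  by apply: eq_bigr => v _; rewrite mulrC.
transitivity (cheb_dot L (('X - (centre L)%:P) * cheb L k) (cheb L k.+1)).
  case: k {IHk} => [|k]; first by rewrite mulr1.
  by rewrite {1}chebSS dotBl (@cheb_dot_neq L k k.+2) ?mulr0 ?subr0 // neq_ltn leqnSn.
rewrite dotX [RHS]/= -IHk -[X in cheb_dot L _ X](addrNK (cheb_coef L k.+1 *: cheb L k)) -chebSS.
rewrite dotC -[_ *: _]opprK -scaleNr dotBl !(dotC _ (cheb L k)).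
by rewrite cheb_dot_neq ?add0r ?mulNr ?opprK // neq_ltn leqnSn.
Qed.

Lemma cheb_norm_gt0 (L k : nat) : (k < L)%N -> 0 < cheb_norm L k.
Proof.
elim: k => [|k IHk] ltk /=; first by rewrite ltr0n.
apply: mulr_gt0; last by apply: IHk; apply: ltnW.
have k1 : 1 <= k.+1%:R :> rat by rewrite ler1n.
have kL : k.+1%:R < L%:R :> rat by rewrite ltr_nat.
by apply: divr_gt0; [apply: mulr_gt0; nra | nra].
Qed.

(** The value of [cheb L j.*2] at the centre, where the linear factor of the recurrence vanishes. *)
Definition cheb_zero (L j : nat) : rat := \prod_(i < j) - cheb_coef L i.*2.+1.

(** At the centre [up] and [down] both equal [- w]; with the symmetry of [cheb L j.*2] about the
    centre, the difference equation there gives the even formula. The proof runs the recurrence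
    through both parities. *)
Lemma cheb_next_to_centre (L j : nat) : (1 < L)%N ->
  let w : rat := (L%:R ^+ 2 - 1) / 4 in
  (cheb L j.*2).[centre L + 1]
    = cheb_zero L j * (1 - j%:R * (2 * j%:R + 1) / w) /\
  (cheb L j.*2.+1).[centre L + 1]
    = cheb_zero L j * cheb_coef L j.*2.+1 * (4 * j%:R + 3) / w.
Proof.
move=> L_gt1 w.
have w0 : L%:R ^+ 2 - 1 != 0 :> rat.
  have : 2 <= L%:R :> rat by rewrite ler_nat.
  nra.
have kk (k : nat) : 4 * k.+1%:R ^+ 2 - 1 != 0 :> rat.
  have : 1 <= k.+1%:R :> rat by rewrite ler1n.
  nra.
elim: j => [|j [E O]].
  rewrite /cheb_zero big_ord0 /cheb_coef /w /= !hornerE; split; first by field.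
  by rewrite double0; field.
have E' : (cheb L j.+1.*2).[centre L + 1]
    = cheb_zero L j.+1 * (1 - j.+1%:R * (2 * j.+1%:R + 1) / w).
  rewrite doubleS horner_chebSS E O /cheb_zero big_ord_recr /= /w -natr1.
  by field.
split=> //; rewrite doubleS horner_chebSS -doubleS E' O doubleS /cheb_zero big_ord_recr /=.
rewrite /w.
have := kk j.*2; have := kk j.*2.+1; have := kk j.*2.+2.
rewrite /cheb_coef -!natr1 -muln2 natrM => k2 k1 k0.
by field; rewrite w0 k0 k1 k2.
Qed.

(** The kernel summand of index [2j] at the centre; the terms of the kernel are rational multiples
    of such ratios. *)
Definition cheb_ratio (L j : nat) : rat := cheb_zero L j ^+ 2 / cheb_norm L j.*2.

Lemma cheb_coef_gt0 (L j : nat) : (j.*2.+2 < L)%N ->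
  [/\ 0 < cheb_coef L j.*2.+1, 0 < cheb_coef L j.*2.+2 & 0 < cheb_norm L j.*2].
Proof.
move=> lt; have h0 := cheb_norm_gt0 (ltnW (ltnW lt)).
have h1 := cheb_norm_gt0 (ltnW lt); have h2 := cheb_norm_gt0 lt.
split=> //; first by move: h1; rewrite /= pmulr_lgt0.
by move: h2; rewrite -[cheb_norm _ _]/(_ * cheb_norm L j.*2.+1) pmulr_lgt0.
Qed.

Lemma cheb_ratioS (L j : nat) : (j.*2.+2 < L)%N ->
  cheb_ratio L j.+1 = cheb_ratio L j * cheb_coef L j.*2.+1 / cheb_coef L j.*2.+2.
Proof.
move=> lt; rewrite /cheb_ratio doubleS /= /cheb_zero big_ord_recr /=.
have [b1 b2 h0] := cheb_coef_gt0 lt.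
move: b1 b2 h0 (\prod_(i < j) _); move: (cheb_coef L _) (cheb_coef L _) (cheb_norm L _).
by move=> b b' h /lt0r_neq0 b0 /lt0r_neq0 b0' /lt0r_neq0 h0 q; field; rewrite b0 b0' h0.
Qed.

(** These are the two summands that enter the kernel when [n] grows by one. *)
Lemma kernel_terms (L j : nat) : (j.*2.+2 < L)%N ->
  let w : rat := (L%:R ^+ 2 - 1) / 4 in
  (cheb L j.*2.+1).[centre L + 1] ^+ 2 / cheb_norm L j.*2.+1
  + (cheb L j.*2.+2).[centre L + 1] ^+ 2 / cheb_norm L j.*2.+2
  = cheb_ratio L j * cheb_coef L j.*2.+1 * ((4 * j%:R + 3) ^+ 2 / w ^+ 2
      + (1 - (j%:R + 1) * (2 * j%:R + 3) / w) ^+ 2 / cheb_coef L j.*2.+2).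
Proof.
move=> lt w; have L_gt1 : (1 < L)%N by apply: leq_ltn_trans lt.
have [_ ->] := cheb_next_to_centre j L_gt1; have [] := cheb_next_to_centre j.+1 L_gt1.
rewrite doubleS => -> _; rewrite -/w /cheb_zero big_ord_recr -/(cheb_zero L j) /=.
have [b1 b2 h0] := cheb_coef_gt0 lt.
have w0 : w != 0.
  have : 2 <= L%:R :> rat by rewrite ler_nat.
  rewrite /w; nra.
rewrite /cheb_ratio -natr1; move: b1 b2 h0 w0 (cheb_zero L j).
move: w (cheb_coef L _) (cheb_coef L _) (cheb_norm L _).
by move=> w b b' h /lt0r_neq0 b0 /lt0r_neq0 b0' /lt0r_neq0 h0 w0 q; field; rewrite b0 b0' h0 w0.
Qed.

(** * The triple product *)

Lemma cheb_norm_fact (L k : nat) : (k < L)%N ->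
  cheb_norm L k
  = k`!%:R ^+ 4 * (L + k)`!%:R
    / ((2 * k)`!%:R * (2 * k).+1`!%:R * (L - k.+1)`!%:R).
Proof.
have fact0 n : n`!%:R != 0 :> rat by rewrite pnatr_eq0 -lt0n fact_gt0.
elim: k => [|k IHk] ltk.
  case: L ltk => // L _.
  rewrite addn0 subn1 /= factS natrM !expr1n !mul1r.
  by rewrite mulfK.
rewrite /= IHk ?(ltnW ltk) // /cheb_coef.
have eL : (L - k.+1)%N = (L - k.+2).+1 by lia.
have := fact0 (L - k.+2)%N; have := fact0 (L + k)%N; have := fact0 (2 * k)%N.
have := fact0 k; rewrite eL addnS mulnS !addSn add0n !factS !natrM.
have -> : (L - k.+2).+1%:R = L%:R - k%:R - 1 :> rat.
  by rewrite -eL natrB ?(ltnW ltk) // -natr1; ring.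
have lt1 : k%:R + 1 < L%:R :> rat by rewrite natr1 ltr_nat.
have k0 : 0 <= k%:R :> rat by [].
rewrite -!natr1 natrD natrM.
move: (k`!%:R) ((2 * k)`!%:R) ((L + k)`!%:R) ((L - k.+2)`!%:R) => a b c d a0 b0 c0 d0.
field; rewrite b0 d0 /=.
repeat (apply/andP; split); nra.
Qed.

Lemma prod_consecutive (R : comNzRingType) (N r : nat) :
  \prod_(0 <= k < N) (r + k.+1)%:R * r`!%:R = (N + r)`!%:R :> R.
Proof.
elim: N => [|N IHN]; first by rewrite big_geq ?mul1r.
by rewrite big_nat_recr //= mulrAC IHN mulrC -natrM addnS addnC.
Qed.

(** The product over [j] telescopes, and the one over [k] then becomes a quotient of factorials; the
    rest rearranges the factorials in [cheb_norm_fact]. *)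
Lemma box_product (N M : nat) :
  \prod_(1 <= i < N.+1) \prod_(1 <= j < M.+1) \prod_(1 <= k < N.+1)
     ((i%:R + j%:R + k%:R - 1) / (i%:R + j%:R + k%:R - 2))
  = \prod_(k < N) (cheb_norm (N + M) k / k`!%:R ^+ 2).
Proof.
have fact0 n : n`!%:R != 0 :> rat by rewrite pnatr_eq0 -lt0n fact_gt0.
transitivity (\prod_(0 <= i < N) ((N + (M + i))`!%:R / (M + i)`!%:R
                                  / ((N + i)`!%:R / i`!%:R)) : rat).
  rewrite big_add1 /=; apply: eq_bigr => i _.
  rewrite exchange_big /= big_add1 /=.
  have step k : \prod_(1 <= j < M.+1)
      ((i.+1%:R + j%:R + k.+1%:R - 1) / (i.+1%:R + j%:R + k.+1%:R - 2))
      = (M + i + k.+1)%:R / (i + k.+1)%:R :> rat.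
    rewrite big_add1 /=.
    under eq_big_nat => j _.
      rewrite (_ : i.+1%:R + _ + _ - 1 = (j.+1 + i + k.+1)%:R); last first.
        by rewrite !natrD -!natr1; ring.
      rewrite (_ : i.+1%:R + _ + _ - 2 = (j + i + k.+1)%:R); last first.
        by rewrite !natrD -!natr1; ring.
      over.
    have nz j : (j + i + k.+1)%:R != 0 :> rat by rewrite pnatr_eq0 addnS.
    case: (posnP M) => [->|M_gt0]; first by rewrite big_geq // divff.
    by rewrite (telescope_prodf (f := fun j => (j + i + k.+1)%:R)).
  under eq_bigr do rewrite step.
  rewrite prodf_div -!(prod_consecutive _ N) !mulfK //.
rewrite big_mkord.
under [RHS]eq_bigr => k _ do rewrite cheb_norm_fact ?ltn_addr //.
have rev_fact : \prod_(k < N) (N + M - k.+1)`!%:R = \prod_(k < N) (M + k)`!%:R :> rat.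
  rewrite (reindex_inj rev_ord_inj) /=; apply: eq_bigr => k _.
  by congr (_`!%:R); have := ltn_ord k; lia.
(* Both sides group the product of all [j!] with [j < 2N]. *)
have double_fact : \prod_(k < N) ((2 * k)`!%:R * (2 * k).+1`!%:R)
    = \prod_(k < N) (k`!%:R * (N + k)`!%:R) :> rat.
  elim: {+}N => [|n IHn]; first by rewrite !big_ord0.
  rewrite !big_ord_recr /= IHn.
  transitivity ((\prod_(i < n) i`!%:R) * (\prod_(i < n.+2) (n + i)`!%:R) : rat).
    by rewrite big_split /= !big_ord_recr /= addnn addnS addnn mul2n; ring.
  rewrite big_ord_recl [in RHS]big_split /= big_ord_recr /= addn0.
  have shift i : (n + bump 0 i = n.+1 + i)%N by rewrite /bump; lia.
  have -> : \prod_(i < n) (n + bump 0 i)`!%:R = \prod_(i < n) (n.+1 + i)`!%:R :> rat.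
    by apply: eq_bigr => i _; rewrite shift.
  by rewrite shift; ring.
transitivity (\prod_(k < N) (k`!%:R * (N + M + k)`!%:R)
   / (\prod_(k < N) (k`!%:R * (N + k)`!%:R)) * (\prod_(k < N) k`!%:R)
     / \prod_(k < N) (M + k)`!%:R : rat).
  rewrite -!prodf_div -big_split -prodf_div /=; apply: eq_bigr => k _.
  by rewrite addnA; field; rewrite !fact0.
rewrite -double_fact -rev_fact -prodf_div -big_split -prodf_div /=.
by apply: eq_bigr => k _; field; rewrite !fact0.
Qed.

(** * Closed form of the kernel *)

Lemma shifted_factorialS (a : rat) (k : nat) :
  shifted_factorial a k.+1 = shifted_factorial a k * (a + k%:R).
Proof. by rewrite /shifted_factorial big_nat_recr. Qed.

Lemma shifted_factorial_shift (a : rat) (k : nat) :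
  shifted_factorial a k * (a + k%:R) = a * shifted_factorial (a + 1) k.
Proof.
elim: k => [|k IHk]; first by rewrite /shifted_factorial !big_geq // mul1r addr0 mulr1.
by rewrite !shifted_factorialS mulrA -IHk -natr1; ring.
Qed.

Lemma shifted_factorial_neq0 (a : rat) (k : nat) :
  (forall i, (i < k)%N -> a + i%:R != 0) -> shifted_factorial a k != 0.
Proof.
elim: k => [|k IHk] nz; first by rewrite /shifted_factorial big_geq // oner_neq0.
by rewrite shifted_factorialS mulf_neq0 ?nz // IHk // => i lt; apply/nz/ltnW.
Qed.

(** The number is half an odd integer. *)
Lemma half_odd_neq (i n : nat) : 5 / 2 - n%:R + i%:R != 0 :> rat.
Proof.
have -> : 5 / 2 - n%:R + i%:R = ((5 + 2 * i)%:R - (2 * n)%:R) / 2 :> rat.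
  by rewrite natrD !natrM; field.
rewrite mulf_neq0 // subr_eq0 eqr_nat; lia.
Qed.

(** The factors of the summand that depend on [n] alone; those in [n + m] collapse to linear factors
    in [summandE]. *)
Definition poised (n h : nat) : rat :=
  shifted_factorial (2 - n%:R) h * shifted_factorial (3 / 2 + n%:R) h
  / (shifted_factorial (2 + n%:R) h * shifted_factorial (5 / 2 - n%:R) h).

Lemma poised_den (n h : nat) :
  (shifted_factorial (2 + n%:R) h != 0) * (shifted_factorial (5 / 2 - n%:R) h != 0)
  * (2 + n%:R + h%:R != 0 :> rat).
Proof.
have n0 i : 2 + n%:R + i%:R != 0 :> rat.
  have : 0 <= n%:R + i%:R :> rat by rewrite -natrD.
  lra.
split; last exact: n0.
by split; apply: shifted_factorial_neq0 => i _; [apply: n0|apply: half_odd_neq].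
Qed.

Lemma poisedS (n h : nat) :
  poised n h.+1
  = poised n h * ((2 - n%:R + h%:R) * (3 / 2 + n%:R + h%:R))
    / ((2 + n%:R + h%:R) * (5 / 2 - n%:R + h%:R)).
Proof.
have [[d1 d2] d3] := poised_den n h; have d4 := half_odd_neq h n.
rewrite /poised !shifted_factorialS.
move: (shifted_factorial _ _) (shifted_factorial (5 / 2 - _) _) d1 d2 => a b a0 b0.
move: (shifted_factorial (2 - _) h) (shifted_factorial (3 / 2 + _) h) => e f.
move: (2 + _ + _) (5 / 2 - _ + _) d3 d4 => p q p0 q0.
by field; rewrite a0 b0 p0 q0.
Qed.

Definition weight (h : nat) : rat :=
  (h%:R + 1) * (h%:R + 2) * (2 * h%:R + 3) / 6.

Lemma weightE (h : nat) :
  shifted_factorial 3 h * shifted_factorial (5 / 2) h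
  = weight h * (shifted_factorial 1 h * shifted_factorial (3 / 2) h).
Proof.
elim: h => [|h IHh]; first by rewrite /shifted_factorial !big_geq // /weight; field.
by rewrite !shifted_factorialS mulrACA IHh /weight -natr1; field.
Qed.

(* The summand is Gosper-summable: the antidifference is [poised n h] times a
   cubic in [h], found by undetermined coefficients. *)
Lemma sum_weight_poised (n k : nat) :
  \sum_(0 <= h < k) weight h * poised n h
  = n%:R * (n%:R + 1) * (2 * n%:R - 1) * (2 * n%:R - 3) / 18
    + ((k%:R + 1) ^+ 2 - 1 - n%:R + 2 * n%:R ^+ 2) / 9
      * (k%:R + 1 + n%:R) * (k%:R + 3 / 2 - n%:R) * poised n k.
Proof.
elim: k => [|k IHk].
  by rewrite big_geq // /poised /shifted_factorial !big_geq //; field.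
rewrite big_nat_recr //= IHk poisedS.
have [_ d1] := poised_den n k; have d2 := half_odd_neq k n.
rewrite /weight -[k.+1%:R]natr1; move: (n%:R) (k%:R) (poised n k) d1 d2 => x t r d1 d2.
field; rewrite d1 andbT; apply: contraNneq d2 => e; apply/eqP; lra.
Qed.

Lemma poised_end (n : nat) : (1 < n)%N -> poised n n.-1 = 0.
Proof.
case: n => [|[|n]] // _; rewrite /poised /= shifted_factorialS -[n.+2%:R]natr1 -[n.+1%:R]natr1.
by rewrite (_ : 2 - (n%:R + 1 + 1) + n%:R = 0) ?mulr0 ?mul0r //; ring.
Qed.

(** All shifted factorials at [n.+1] and [n] have bases differing by 1, so each quotient is linear
    over linear. This relates the sums for consecutive [n]. *)
Lemma poised_contiguous (n h : nat) :
  n%:R * poised n.+1 h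
    * ((1 - n%:R + h%:R) * (2 + n%:R + h%:R)) * (9 / 4 - n%:R ^+ 2)
  = - (n%:R * (n%:R + 2)) * ((n%:R - 1) * poised n h)
    * ((3 / 2 - n%:R + h%:R) * (3 / 2 + n%:R + h%:R)).
Proof.
have [[a0 b0] d3] := poised_den n h; have [[e0 f0] _] := poised_den n.+1 h.
have s1 := shifted_factorial_shift (1 - n%:R) h.
have s2 := shifted_factorial_shift (3 / 2 + n%:R) h.
have s3 := shifted_factorial_shift (2 + n%:R) h.
have s4 := shifted_factorial_shift (3 / 2 - n%:R) h.
rewrite (_ : 1 - n%:R + 1 = 2 - n%:R) in s1; last by ring.
rewrite (_ : 3 / 2 - n%:R + 1 = 5 / 2 - n%:R) in s4; last by field.
rewrite /poised -[n.+1%:R]natr1 in e0 f0 *.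
rewrite (_ : 2 - (n%:R + 1) = 1 - n%:R) in e0 f0 *; last by ring.
rewrite (_ : 5 / 2 - (n%:R + 1) = 3 / 2 - n%:R) in e0 f0 *; last by field.
rewrite ![_ + (n%:R + 1)]addrA in e0 f0 *.
move: s1 s2 s3 s4 a0 b0 e0 f0.
move: (shifted_factorial (1 - _) h) (shifted_factorial (2 - _) h) => A A'.
move: (shifted_factorial (3 / 2 + _) h) (shifted_factorial (3 / 2 + _ + 1) h) => B B'.
move: (shifted_factorial (2 + _) h) (shifted_factorial (2 + _ + 1) h) => C C'.
move: (shifted_factorial (3 / 2 - _) h) (shifted_factorial (5 / 2 - _) h) => D D'.
move=> s1 s2 s3 s4 C0 D0' C0' D0.
have n0 : 0 <= n%:R :> rat by [].
have nd : 3 / 2 + n%:R != 0 :> rat by lra.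
have nd2 : 2 + n%:R != 0 :> rat by lra.
have nd3 : 3 / 2 - n%:R != 0 :> rat.
  have hn := half_odd_neq 0 n.+1; rewrite -[n.+1%:R]natr1 in hn.
  by apply: contraNneq hn => e; apply/eqP; lra.
have eB : B' = B * (3 / 2 + n%:R + h%:R) / (3 / 2 + n%:R) by rewrite s2 mulrC mulKf.
have eC : C' = C * (2 + n%:R + h%:R) / (2 + n%:R) by rewrite s3 mulrC mulKf.
have eD : D' = D * (3 / 2 - n%:R + h%:R) / (3 / 2 - n%:R) by rewrite s4 mulrC mulKf.
have nd4 : 3 / 2 - n%:R + h%:R != 0 :> rat.
  by apply: contraNneq D0' => e; rewrite eD e mulr0 mul0r.
(* The base [1 - n] vanishes for [n = 1], so [s1] is used as a product, while [s2], [s3] and [s4]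
   could be solved for a quotient. *)
transitivity ((A * (1 - n%:R + h%:R)) * (n%:R * B' * (2 + n%:R + h%:R)
   * (9 / 4 - n%:R ^+ 2) / (C' * D))); first by field; rewrite D0 C0'.
rewrite s1 eB eC eD; move: n%:R h%:R d3 nd nd2 nd3 nd4 => x t d3 nd nd2 nd3 nd4.
field; rewrite D0 C0 nd2 d3 /=.
by apply/and3P; split; [apply: contraNneq nd3|apply: contraNneq nd4
  |apply: contraNneq nd] => e; apply/eqP; lra.
Qed.

(** * Binomial recurrences and the prefactor *)

Lemma bin_central_odd (k : nat) :
  'C(2 * k.+1, k.+1)%:R = 2 * 'C((2 * k).+1, k)%:R :> rat.
Proof.
have := mul_bin_diag (2 * k.+1) k.
rewrite (_ : (2 * k.+1).-1 = (2 * k).+1)%N; last by lia.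
move/(congr1 (fun x : nat => x%:R : rat)); rewrite !natrM [2 * _]mulrC -!mulrA.
by move/mulfI => -> //; rewrite pnatr_eq0.
Qed.

Lemma bin_odd_central (k : nat) :
  (k%:R + 1) * 'C((2 * k).+1, k)%:R = (2 * k%:R + 1) * 'C(2 * k, k)%:R :> rat.
Proof.
have := mul_bin_diag (2 * k).+1 k.
have -> : 'C((2 * k).+1, k.+1) = 'C((2 * k).+1, k).
  by rewrite -bin_sub; [congr 'C(_, _)|]; lia.
move/(congr1 (fun x : nat => x%:R : rat)); rewrite !natrM /= natr1 => <-.
by rewrite -[(2 * k).+1%:R]natr1 natrM.
Qed.

Lemma bin_centralS (k : nat) :
  (k%:R + 1) * 'C(2 * k.+1, k.+1)%:R = 2 * (2 * k%:R + 1) * 'C(2 * k, k)%:R :> rat.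
Proof. by rewrite bin_central_odd mulrCA bin_odd_central mulrA. Qed.

Lemma bin_oddS (k : nat) :
  (k%:R + 2) * 'C((2 * k.+1).+1, k.+1)%:R
  = 2 * (2 * k%:R + 3) * 'C((2 * k).+1, k)%:R :> rat.
Proof.
have := bin_odd_central k.+1; rewrite bin_central_odd -[k.+1%:R]natr1.
by rewrite (_ : k%:R + 1 + 1 = k%:R + 2) => [->|]; ring.
Qed.

Lemma binom_quotientS (n : nat) : (0 < n)%N ->
  n%:R * binom_quotient n.+1 = 2 * (2 * n%:R - 3) * binom_quotient n.
Proof.
case: n => [|[|n]] // _.
rewrite /binom_quotient eqSS /= (_ : n.+2 - 2 = n)%N; last by lia.
rewrite (_ : n.+3 - 2 = n.+1)%N; last by lia.
rewrite (_ : 2 * n.+3 - 4 = 2 * n.+1)%N; last by lia.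
rewrite (_ : 2 * n.+2 - 4 = 2 * n)%N; last by lia.
have := bin_centralS n; rewrite -[n.+3%:R]natr1 -[n.+2%:R]natr1 -[n.+1%:R]natr1 => e.
have n1 : n%:R + 1 != 0 :> rat by rewrite natr1 pnatr_eq0.
have n2 : n%:R + 1 + 1 != 0 :> rat by rewrite !natr1 pnatr_eq0.
rewrite !addrK mulrCA mulfV // mulr1.
apply: (mulfI n1); rewrite e; field; exact: n1.
Qed.

Definition prefactor (n m : nat) : rat :=
  (2 * m%:R - 1) * 'C(2 * m - 2, m - 1)%:R * 'C(2 * n + 2, n + 1)%:R
  / ((n%:R + m%:R - 1) * (n%:R + m%:R) * 'C(4 * n + 2 * m - 3, 2 * n + m - 2)%:R)
  * binom_quotient n.

(** The step keeps [n + m] fixed, and with it the number [L] of the polynomials, as the induction on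
    the kernel requires. *)
Lemma prefactorS (n m : nat) : (0 < n)%N -> (0 < m)%N ->
  prefactor n.+1 m
  = prefactor n m.+1 * (m%:R * (2 * n%:R + m%:R + 1) * (2 * n%:R + 3) * (2 * n%:R - 3))
    / ((2 * m%:R + 1) * (4 * n%:R + 2 * m%:R + 1) * n%:R * (n%:R + 2)).
Proof.
case: m => // m n_gt0 _; rewrite /prefactor.
rewrite (_ : 2 * m.+1 - 2 = 2 * m)%N; last by lia.
rewrite (_ : 2 * m.+2 - 2 = 2 * m.+1)%N; last by lia.
rewrite (_ : 2 * n + 2 = 2 * n.+1)%N; last by lia.
rewrite (_ : 2 * n.+1 + 2 = 2 * n.+2)%N; last by lia.
rewrite (_ : m.+1 - 1 = m)%N; last by lia.
rewrite (_ : m.+2 - 1 = m.+1)%N; last by lia.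
rewrite !addn1.
rewrite (_ : 4 * n.+1 + 2 * m.+1 - 3 = (2 * (2 * n + m).+1).+1)%N; last by lia.
rewrite (_ : 4 * n + 2 * m.+2 - 3 = (2 * (2 * n + m)).+1)%N; last by lia.
rewrite (_ : 2 * n.+1 + m.+1 - 2 = (2 * n + m).+1)%N; last by lia.
rewrite (_ : 2 * n + m.+2 - 2 = 2 * n + m)%N; last by lia.
have := bin_centralS m; have := bin_centralS n.+1; have := bin_oddS (2 * n + m).
have := binom_quotientS n_gt0.
have c0 k j : (j <= k)%N -> 'C(k, j)%:R != 0 :> rat.
  by move=> le; rewrite pnatr_eq0 -lt0n bin_gt0.
have : 'C((2 * (2 * n + m).+1).+1, (2 * n + m).+1)%:R != 0 :> rat by apply: c0; lia.
have : 'C((2 * (2 * n + m)).+1, 2 * n + m)%:R != 0 :> rat by apply: c0; lia.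
move: ('C(2 * m, m)%:R) ('C(2 * m.+1, m.+1)%:R) => a a'.
move: ('C(2 * n.+1, n.+1)%:R) ('C(2 * n.+2, n.+2)%:R) => b b'.
move: ('C((2 * (2 * n + m)).+1, 2 * n + m)%:R)
  ('C((2 * (2 * n + m).+1).+1, (2 * n + m).+1)%:R) => d d'.
move: (binom_quotient n) (binom_quotient n.+1) => q q' d0 d0'.
have n1 : 1 <= n%:R :> rat by rewrite ler1n.
have m0 : 0 <= m%:R :> rat by [].
rewrite -[m.+2%:R]natr1 -[n.+1%:R]natr1 -[m.+1%:R]natr1 natrD natrM.
move: n1 m0; move: (n%:R) (m%:R) => x y x1 y0 eq_q eq_d eq_b eq_a.
have -> : q' = 2 * (2 * x - 3) * q / x by rewrite -eq_q mulrC mulKf //; lra.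
have -> : d' = 2 * (2 * (2 * x + y) + 3) * d / (2 * x + y + 2).
  by rewrite -eq_d mulrC mulKf //; lra.
have -> : b' = 2 * (2 * (x + 1) + 1) * b / (x + 1 + 1).
  by rewrite -eq_b mulrC mulKf //; lra.
have -> : a' = 2 * (2 * y + 1) * a / (y + 1).
  by rewrite -eq_a mulrC mulKf //; lra.
field; rewrite d0 /=; repeat (apply/andP; split); lra.
Qed.

Lemma odd_factor_neq0 (n : nat) : 2 * n%:R - 3 != 0 :> rat.
Proof. by rewrite -natrM subr_eq0 eqr_nat; lia. Qed.

(** Ties the binomials to the kernel: along fixed [n + m] both sides obey matching recurrences,
    [prefactorS] and [cheb_ratioS]. The initial case uses the limit value of [binom_quotient] at
    1. *)
Lemma prefactorE (n m : nat) : (0 < m)%N ->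
  let x : rat := n%:R + 1 in let y : rat := m%:R in
  prefactor n.+1 m
  = (2 * x + 1) * (2 * x - 1) * y * (2 * x + y - 1)
    / ((2 * x - 3) * x * (x + 1) * (4 * x - 3) * (x + y) * (x + y - 1))
    * cheb_ratio (2 * (n + m)).+1 n.
Proof.
move=> m_gt0 x y; rewrite {}/x {}/y; elim: n m m_gt0 => [|n IHn] m m_gt0.
  rewrite /cheb_ratio /cheb_zero big_ord0 /= expr1n add0n /prefactor.
  case: m m_gt0 => // m _.
  rewrite (_ : 2 * m.+1 - 2 = 2 * m)%N; last by lia.
  rewrite (_ : m.+1 - 1 = m)%N; last by lia.
  rewrite (_ : 4 * 1 + 2 * m.+1 - 3 = (2 * m.+1).+1)%N; last by lia.
  rewrite (_ : 2 * 1 + m.+1 - 2 = m.+1)%N; last by lia.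
  have := bin_odd_central m.+1; have := bin_centralS m.
  have : 'C((2 * m.+1).+1, m.+1)%:R != 0 :> rat.
    by rewrite pnatr_eq0 -lt0n bin_gt0; lia.
  rewrite /binom_quotient eqxx (_ : 'C(2 * 1 + 2, 1 + 1) = 6)%N //.
  rewrite -[(2 * m.+1).+1%:R]natr1 natrM -[m.+1%:R]natr1.
  move: ('C((2 * m.+1).+1, m.+1)%:R) ('C(2 * m.+1, m.+1)%:R) ('C(2 * m, m)%:R) => a b c.
  have m0 : 0 <= m%:R :> rat by [].
  move: m0; move: (m%:R) => y y0 a0 eq_b eq_a.
  have eb : b = 2 * (2 * y + 1) * c / (y + 1) by rewrite -eq_b mulrC mulKf //; lra.
  have ea : a = (2 * (y + 1) + 1) * b / (y + 1 + 1) by rewrite -eq_a mulrC mulKf //; lra.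
  have c0 : c != 0 by apply: contraNneq a0 => c0; rewrite ea eb c0 mulr0 mul0r mulr0 mul0r.
  rewrite ea eb; field; rewrite c0 /=; repeat (apply/andP; split); lra.
rewrite prefactorS // IHn // addSnnS cheb_ratioS; last by lia.
rewrite /cheb_coef -[(2 * (n + m.+1)).+1%:R]natr1 natrM natrD.
rewrite -[n.*2.+2%:R]natr1 -[n.*2.+1%:R]natr1 -mul2n natrM -[n.+1%:R]natr1 -[m.+1%:R]natr1.
have y1 : 1 <= m%:R :> rat by rewrite ler1n.
have x0 : 0 <= n%:R :> rat by [].
have := odd_factor_neq0 n.+1; have := odd_factor_neq0 n.+2.
rewrite -[n.+2%:R]natr1 -[n.+1%:R]natr1; move: y1 x0 (cheb_ratio _ _).
move: (n%:R) (m%:R) => x y y1 x0 r o1 o2.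
field; rewrite o1 o2 /=; repeat (apply/andP; split); first [lra|nra].
Qed.

Lemma poised_last (n : nat) : n%:R * poised n.+1 n = 0.
Proof. by case: n => [|n]; rewrite ?mul0r ?poised_end ?mulr0. Qed.

(** The factor [n] removes the boundary term, as [poised n.+1 n] is 1 for [n = 0]. *)
Lemma sum_poised (n : nat) :
  n%:R * \sum_(0 <= h < n) weight h * poised n.+1 h
  = n%:R * ((n%:R + 1) * (n%:R + 2) * (2 * n%:R + 1) * (2 * n%:R - 1) / 18).
Proof.
rewrite sum_weight_poised mulrDr -[n.+1%:R]natr1.
rewrite [X in _ + X](_ : _ = 0); first by rewrite addr0; field.
by rewrite mulrCA poised_last mulr0.
Qed.

(* Shifted by one in [n]; the factor [n] inside the sum makes the term of index
   [n] vanish also for [n = 0], where [poised 1 0 = 1]. *)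
Definition well_poised_sum (n m : nat) : rat :=
  \sum_(0 <= h < n) weight h * (n%:R * poised n.+1 h)
    / ((h%:R + 1 - n%:R - m%:R) * (h%:R + 2 + n%:R + m%:R)).

(** Both sums have the same [n + m], hence the same denominators. By [poised_contiguous] these
    denominators cancel in the difference of the summands, and [sum_poised] evaluates what
    remains. *)
Lemma prefactor_well_poised_sum (n m : nat) : (0 < m)%N ->
  let x : rat := n%:R + 1 in let y : rat := m%:R in
  prefactor n.+2 m * well_poised_sum n.+1 m
  = prefactor n.+1 m.+1 * (well_poised_sum n m.+1
     + 4 / ((2 * y + 1) * (4 * x + 2 * y + 1))
       * ((x - 1) * (x * (x + 1) * (2 * x - 1) * (2 * x - 3) / 18)
          - (2 * x + 3) * (2 * x - 3) / (4 * (x + 2))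
            * ((x + 1) * (x + 2) * (2 * x + 1) * (2 * x - 1) / 18))).
Proof.
move=> m_gt0 x y.
have xE : n.+1%:R = x by rewrite -natr1.
have y1 : 1 <= y by rewrite ler1n.
have x1 : 1 <= x by rewrite -xE ler1n.
rewrite prefactorS // xE -/y; move: (prefactor _ _) => c.
rewrite -!mulrA; congr (_ * _).
(* The closed forms are turned back into sums over a common range, so that the identity can be
   checked term by term. *)
have -> : (x - 1) * (x * ((x + 1) * ((2 * x - 1) * ((2 * x - 3) / 18))))
    = \sum_(0 <= h < n.+1) weight h * (n%:R * poised n.+1 h).
  rewrite big_nat_recr //= poised_last mulr0 addr0.
  rewrite (_ : \sum_(0 <= h < n) _ = n%:R * \sum_(0 <= h < n) weight h * poised n.+1 h).
    by rewrite sum_poised /x; field.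
  by rewrite mulr_sumr; apply: eq_bigr => h _; rewrite mulrCA.
have -> : (x + 1) * ((x + 2) * ((2 * x + 1) * ((2 * x - 1) / 18)))
    = \sum_(0 <= h < n.+1) weight h * poised n.+2 h.
  have xn : n.+1%:R != 0 :> rat by rewrite pnatr_eq0.
  by apply: (mulfI xn); rewrite sum_poised xE; field.
have -> : well_poised_sum n m.+1 = \sum_(0 <= h < n.+1) weight h * (n%:R * poised n.+1 h)
    / ((h%:R + 1 - n%:R - m.+1%:R) * (h%:R + 2 + n%:R + m.+1%:R)).
  by rewrite big_nat_recr //= poised_last mulr0 mul0r addr0.
rewrite !mulr_sumr -sumrB !mulr_sumr -big_split /=.
apply: eq_big_nat => h /andP[_ lt_h].
have := poised_contiguous n.+1 h.
rewrite xE -[m.+1%:R]natr1 -/y (_ : n%:R = x - 1); last by rewrite /x addrK.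
have h_x : h%:R + 1 <= x by rewrite -xE natr1 ler_nat.
have h0 : 0 <= h%:R :> rat by [].
move: h_x h0; move: (h%:R) (poised n.+1 h) (poised n.+2 h) (weight h) => t p p' w h_x h0 e.
move: x y x1 y1 xE h_x e => x y x1 y1 _ h_x e.
have e' : (2 * x + 3) * (2 * x - 3) * (x * p') * ((1 - x + t) * (2 + x + t))
   = 4 * (x * (x + 2)) * ((x - 1) * p) * ((3 / 2 - x + t) * (3 / 2 + x + t)).
  by transitivity (- 4 * (x * p' * ((1 - x + t) * (2 + x + t)) * (9 / 4 - x ^+ 2)));
    [field|rewrite e; field].
apply/eqP; rewrite -subr_eq0; apply/eqP.
transitivity (w / ((2 * y + 1) * (4 * x + 2 * y + 1) * (x * (x + 2))
     * ((t + 1 - x - y) * (t + 2 + x + y)))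
   * ((2 * x + 3) * (2 * x - 3) * (x * p') * ((1 - x + t) * (2 + x + t))
      - 4 * (x * (x + 2)) * ((x - 1) * p) * ((3 / 2 - x + t) * (3 / 2 + x + t)))).
  by field; repeat (apply/andP; split); lra.
by rewrite e' subrr mulr0.
Qed.

(** Induction on [n] for all [m], passing from [(n, m + 1)] to [(n + 1, m)] with [L] unchanged. The
    new summands and the prefactor are rational multiples of one [cheb_ratio], which leaves a
    rational identity. *)
Theorem kernel_closed_form (n m : nat) : (0 < m)%N ->
  let x : rat := n%:R + 1 in let s : rat := x + m%:R in
  let L := (2 * (n + m)).+1 in
  \sum_(k < (2 * n).+1) (cheb L k).[centre L + 1] ^+ 2 / cheb_norm L k
  = prefactor n.+1 m
    * (x * (x + 1) * (2 * x - 3) * (2 * x - 1) * (s ^+ 2 - s - 2 * x + 2)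
         / ((s - 1) * s * (2 * x + 1))
       - 6 * well_poised_sum n m).
Proof.
elim: n m => [|n IHn] m m_gt0 x s L.
  have y1 : 1 <= m%:R :> rat by rewrite ler1n.
  rewrite big_ord1 /= hornerE expr1n /well_poised_sum big_geq // prefactorE //.
  rewrite /cheb_ratio /cheb_zero big_ord0 /= expr1n mulr0 subr0.
  rewrite /L /s /x -[(2 * (0 + m)).+1%:R]natr1 natrM natrD.
  move: y1; move: (m%:R) => y y1.
  by field; repeat (apply/andP; split); lra.
have LE : L = (2 * (n + m.+1)).+1 by rewrite /L addSnnS.
have eqW := prefactor_well_poised_sum n m_gt0.
rewrite (_ : (2 * n.+1).+1 = (2 * n).+3)%N; last by lia.
have IH := IHn m.+1 (ltn0Sn m); rewrite /= -LE in IH.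
rewrite 2!big_ord_recr /= -addrA IH.
have := @kernel_terms L n; rewrite -mul2n => -> ; last by rewrite /L; lia.
rewrite [RHS]mulrBr [prefactor n.+2 m * (6 * _)]mulrCA eqW.
rewrite (@prefactorS n.+1 m) // (prefactorE _ (ltn0Sn m)) -LE.
move: (well_poised_sum _ _) (cheb_ratio _ _) => W r.
rewrite /cheb_coef /s /x /L -[(2 * (n.+1 + m)).+1%:R]natr1 natrM natrD.
rewrite -[(2 * n).+2%:R]natr1 -[(2 * n).+1%:R]natr1 natrM.
have := odd_factor_neq0 n.+2; have := odd_factor_neq0 n.+1.
rewrite -[n.+2%:R]natr1 -[n.+1%:R]natr1 -[m.+1%:R]natr1.
have y1 : 1 <= m%:R :> rat by rewrite ler1n.
have x0 : 0 <= n%:R :> rat by [].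
move: y1 x0; move: (n%:R) (m%:R) => {IHn LE IH L s x}x y y1 x0 o1 o2.
field; rewrite o1 /=; repeat (apply/andP; split); first [lra|nra].
Qed.

(** With [s = x + y], the pairs with bases [2 - s], [3 - s] and [1 + s], [2 + s] reduce to linear
    factors, whose numerators cancel [(s - 2) * (s + 1)] up to the sign. *)
Lemma summandE (n m h : nat) : (0 < m)%N -> (h < n)%N ->
  let x : rat := n%:R + 1 in let y : rat := m%:R in
  6 / ((x + y - 2) * (x + y + 1))
  * ((shifted_factorial 3 h * shifted_factorial (5 / 2) h
      * shifted_factorial (2 - x) h * shifted_factorial (3 / 2 + x) h
      * shifted_factorial (2 - x - y) h * shifted_factorial (1 + x + y) h)
     / (shifted_factorial 1 h * shifted_factorial (3 / 2) h
        * shifted_factorial (2 + x) h * shifted_factorial (5 / 2 - x) h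
        * shifted_factorial (2 + x + y) h * shifted_factorial (3 - x - y) h))
  = - 6 * (weight h * poised n.+1 h
           / ((h%:R + 1 - n%:R - y) * (h%:R + 2 + n%:R + y))).
Proof.
move=> m_gt0 lt_h x y; have xE : n.+1%:R = x by rewrite -natr1.
have s0 : 0 <= x + y by rewrite -xE addr_ge0.
have y1 : 1 <= y by rewrite ler1n.
have hx : h%:R + 2 <= x.
  by rewrite -xE -natrD ler_nat; lia.
have h0 : 0 <= h%:R :> rat by [].
rewrite weightE /poised xE -[2 - x - y]addrA -[3 - x - y]addrA -opprD.
rewrite -[1 + x + y]addrA -[2 + x + y]addrA.
have [[p1 p2] _] := poised_den n.+1 h; rewrite xE in p1 p2.
have pos (a : rat) : 0 < a -> shifted_factorial a h != 0.
  move=> a0; apply: shifted_factorial_neq0 => i _.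
  have : 0 <= i%:R :> rat by [].
  lra.
have q1 : shifted_factorial 1 h != 0 by apply: pos; lra.
have q2 : shifted_factorial (3 / 2) h != 0 by apply: pos; lra.
have q3 : shifted_factorial (2 + (x + y)) h != 0 by apply: pos; lra.
have q4 : shifted_factorial (3 - (x + y)) h != 0.
  apply: shifted_factorial_neq0 => i lt_i.
  have : i%:R + 1 <= h%:R :> rat by rewrite natr1 ler_nat.
  by move=> ih; rewrite ltr0_neq0 //; lra.
have e1 := shifted_factorial_shift (2 - (x + y)) h.
have e2 := shifted_factorial_shift (1 + (x + y)) h.
rewrite (_ : 2 - (x + y) + 1 = 3 - (x + y)) in e1; last by ring.
rewrite (_ : 1 + (x + y) + 1 = 2 + (x + y)) in e2; last by ring.
have nE : n%:R = x - 1 by rewrite /x addrK.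
have d1 : 2 - (x + y) + h%:R != 0 by rewrite ltr0_neq0 //; lra.
have d2 : 1 + (x + y) + h%:R != 0 by rewrite lt0r_neq0 //; lra.
have -> : shifted_factorial (2 - (x + y)) h
    = (2 - (x + y)) * shifted_factorial (3 - (x + y)) h / (2 - (x + y) + h%:R).
  by rewrite -e1 mulfK.
have -> : shifted_factorial (1 + (x + y)) h
    = (1 + (x + y)) * shifted_factorial (2 + (x + y)) h / (1 + (x + y) + h%:R).
  by rewrite -e2 mulfK.
rewrite nE; move: q1 q2 q3 q4 p1 p2.
move: (shifted_factorial 1 h) (shifted_factorial (3 / 2) h) (shifted_factorial (2 + (x + y)) h)
  (shifted_factorial (3 - (x + y)) h) (shifted_factorial (2 + x) h)
  (shifted_factorial (5 / 2 - x) h)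
  (shifted_factorial (2 - x) h) (shifted_factorial (3 / 2 + x) h).
move=> a1 a2 a3 a4 a5 a6 a7 a8 q1 q2 q3 q4 p1 p2.
field; rewrite p2 p1 q4 q3 q2 q1 /= -/y; repeat (apply/andP; split); lra.
Qed.

Lemma prefactor_kernel (n m : nat) : (0 < n)%N -> (0 < m)%N ->
  let x : rat := n%:R in let y : rat := m%:R in
  (2 * y - 1) * 'C(2 * m - 2, m - 1)%:R * 'C(2 * n + 2, n + 1)%:R
    / ((x + y - 1) * (x + y) * 'C(4 * n + 2 * m - 3, 2 * n + m - 2)%:R)
  * (binom_quotient n *
       (x * (x + 1) * (2 * x - 3) * (2 * x - 1)
          * (y ^+ 2 - y - 3 * x + 2 * y * x + x ^+ 2 + 2)
        / ((x + y - 1) * (x + y) * (2 * x + 1)))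
     + 'C(2 * n - 4, n - 2)%:R *
       (6 / ((x + y - 2) * (x + y + 1)) *
        \sum_(0 <= h < n - 1)
          (shifted_factorial 3 h * shifted_factorial (5 / 2) h
           * shifted_factorial (2 - x) h * shifted_factorial (3 / 2 + x) h
           * shifted_factorial (2 - x - y) h * shifted_factorial (1 + x + y) h)
          / (shifted_factorial 1 h * shifted_factorial (3 / 2) h
             * shifted_factorial (2 + x) h * shifted_factorial (5 / 2 - x) h
             * shifted_factorial (2 + x + y) h
             * shifted_factorial (3 - x - y) h)))
  = \sum_(k < 2 * n - 1)
      (cheb (2 * n - 1 + 2 * m) k).[(n + m)%:R] ^+ 2
        / cheb_norm (2 * n - 1 + 2 * m) k.
Proof.
case: n => // n _ m_gt0 x y.
rewrite (_ : 2 * n.+1 - 1 = (2 * n).+1)%N; last by lia.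
rewrite (_ : (2 * n).+1 + 2 * m = (2 * (n + m)).+1)%N; last by lia.
have -> : (n.+1 + m)%:R = centre (2 * (n + m)).+1 + 1 :> rat.
  by rewrite /centre -[(2 * _).+1%:R]natr1 addrK natrM addSn -natr1; field.
rewrite kernel_closed_form // /prefactor -[RHS]mulrA; congr (_ * _).
have xE : x = n%:R + 1 by rewrite /x -natr1.
rewrite [RHS]mulrBr; congr (_ + _).
  by rewrite -xE -/y; congr (_ * (_ * _ / _)); ring.
rewrite subn1 /= mulr_sumr.
rewrite (_ : \sum_(0 <= h < n) _ = \sum_(0 <= h < n) - 6 * (weight h * poised n.+1 h
    / ((h%:R + 1 - n%:R - y) * (h%:R + 2 + n%:R + y)))); last first.
  by apply: eq_big_nat => h /andP[_ lt_h]; rewrite xE summandE.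
(* For [n = 0] truncated subtraction makes the left binomial 1 and the right side has the factor 0,
   but the sums are empty. *)
have -> : 'C(2 * n.+1 - 4, n.+1 - 2)%:R *
    (\sum_(0 <= h < n) - 6 * (weight h * poised n.+1 h
        / ((h%:R + 1 - n%:R - y) * (h%:R + 2 + n%:R + y))))
  = binom_quotient n.+1 * n%:R * (\sum_(0 <= h < n) - 6 * (weight h * poised n.+1 h
        / ((h%:R + 1 - n%:R - y) * (h%:R + 2 + n%:R + y)))).
  case: n {x xE} => [|n]; first by rewrite !big_geq // !mulr0.
  congr (_ * _); rewrite /binom_quotient eqSS /= -[n.+2%:R]natr1.
  by rewrite addrK divfK // pnatr_eq0.
rewrite !mulr_sumr -sumrN; apply: eq_bigr => h _; rewrite -/y.
by move: (_^-1) => d; ring.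
Qed.

Theorem theorem4 (n m : nat) (n_gt0 : (0 < n)%N) (m_gt0 : (0 < m)%N) :
  let x : rat := n%:R in
  let y : rat := m%:R in
  #|[set T : {set {set triangle (2 * n - 1) (2 * m)}} |
      rhombus_tiling T &
      axis_rhombus (2 * n - 1) (2 * m) (n + m) \in T]|%:R =
  (2 * y - 1) * 'C(2 * m - 2, m - 1)%:R * 'C(2 * n + 2, n + 1)%:R
    / ((x + y - 1) * (x + y) * 'C(4 * n + 2 * m - 3, 2 * n + m - 2)%:R)
  * (binom_quotient n *
       (x * (x + 1) * (2 * x - 3) * (2 * x - 1)
          * (y ^+ 2 - y - 3 * x + 2 * y * x + x ^+ 2 + 2)
        / ((x + y - 1) * (x + y) * (2 * x + 1)))
     + 'C(2 * n - 4, n - 2)%:R *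
       (6 / ((x + y - 2) * (x + y + 1)) *
        \sum_(0 <= h < n - 1)
          (shifted_factorial 3 h * shifted_factorial (5 / 2) h
           * shifted_factorial (2 - x) h * shifted_factorial (3 / 2 + x) h
           * shifted_factorial (2 - x - y) h * shifted_factorial (1 + x + y) h)
          / (shifted_factorial 1 h * shifted_factorial (3 / 2) h
             * shifted_factorial (2 + x) h * shifted_factorial (5 / 2 - x) h
             * shifted_factorial (2 + x + y) h
             * shifted_factorial (3 - x - y) h)))
  * \prod_(1 <= i < (2 * n - 1).+1) \prod_(1 <= j < (2 * m).+1)
      \prod_(1 <= k < (2 * n - 1).+1)
        ((i%:R + j%:R + k%:R - 1) / (i%:R + j%:R + k%:R - 2)).
Proof.
move=> x y; rewrite prefactor_kernel // box_product mulrC.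
have N_gt0 : (0 < 2 * n - 1)%N by lia.
have l_lt : (n + m < 2 * n - 1 + 2 * m)%N by lia.
rewrite card_tilings_axis // /is_tiling_chain card_chain ?iota_ltn_sorted ?size_iota //.
  under eq_mx => i j do rewrite nth_iota ?ltn_ord //.
  apply: det_path_count => // [k|k|k lt_k|j k _ _].
  - by rewrite cheb_monic_size.
  - by rewrite cheb_monic_size.
  - by rewrite lt0r_neq0 // cheb_norm_gt0 // ltn_addr.
  have [<-|neq] := eqVneq j k; first by rewrite mulr1n -cheb_dot_self.
  by rewrite mulr0n; apply: cheb_dot_neq.
by apply/allP => v; rewrite mem_iota => /andP[].
Qed.
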